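(* Let $p$ be a prime. If $p$ is a Fermat prime, or $p=4q+1$ where $q$ is a prime, then the dihedral group $D_{2p}$ of order $2p$ is a Schur group.
   Context: A Fermat prime is a prime of the form $2^k+1$ with $k\geq 1$. S-rings and Schur groups: let $G$ be a finite group with identity $e$, and for $X\subseteq G$ put $\underline{X}=\sum_{x\in X}x\in\mathbb{Z}G$. A subring $\mathcal{A}\subseteq\mathbb{Z}G$ is an S-ring over $G$ if there is a partition $\mathcal{S}(\mathcal{A})$ of $G$ such that $\{e\}\in\mathcal{S}(\mathcal{A})$; $X\in\mathcal{S}(\mathcal{A})$ implies $X^{-1}=\{x^{-1}:x\in X\}\in\mathcal{S}(\mathcal{A})$; and $\mathcal{A}=\mathrm{Span}_{\mathbb{Z}}\{\underline{X}:X\in\mathcal{S}(\mathcal{A})\}$. Let $G_r\leq\mathrm{Sym}(G)$ be the group of all right translations $x\mapsto xg$, $g\in G$. For every $K$ with $G_r\leq K\leq \mathrm{Sym}(G)$, the orbits on $G$ of the stabilizer $K_e$ form the partition of an S-ring, denoted $V(K,G)$. An S-ring $\mathcal{A}$ over $G$ is schurian if $\mathcal{A}=V(K,G)$ for some $K$ with $G_r\leq K\leq\mathrm{Sym}(G)$. The group $G$ is a Schur group if every S-ring over $G$ is schurian. *)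

(* Defs.v *)
From HB Require Import structures.
From mathcomp Require Import all_boot all_order all_algebra all_fingroup.
From mathcomp Require Import all_solvable.

Set Implicit Arguments.
Unset Strict Implicit.
Unset Printing Implicit Defensive.

Import GroupScope GRing.Theory.
Local Open Scope ring_scope.

(* A Fermat prime is required to have exponent k >= 1, which excludes p = 2. *)
Definition fermat_prime (p : nat) : Prop :=
  prime p /\ exists2 k : nat, (0 < k)%N & p = (2 ^ k + 1)%N.

(* The integral group ring ZG, where G is the whole of gT: the element        *)
(* \sum_x a_x x is encoded by its coefficient function x |-> a_x, and the     *)
(* product is convolution.                                                    *)
Definition zgring (gT : finGroupType) : Type := {ffun gT -> int}.

HB.instance Definition _ (gT : finGroupType) :=
  GRing.Zmodule.copy (zgring gT) {ffun gT -> int}.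

Section GroupRing.

Variable gT : finGroupType.
Implicit Types a b c : zgring gT.

Definition zgelt (x : gT) : zgring gT := [ffun y => (y == x)%:R].

Definition zgmul a b : zgring gT :=
  [ffun x => \sum_(y : gT) a y * b (y^-1 * x)%g].

Lemma zgmulA : associative zgmul.
Proof.
move=> a b c; apply/ffunP=> x; rewrite !ffunE.
under eq_bigr do rewrite ffunE mulr_sumr.
under [RHS]eq_bigr do rewrite ffunE mulr_suml.
rewrite [RHS]exchange_big; apply: eq_bigr => y _ /=.
rewrite [RHS](reindex_inj (mulgI y)); apply: eq_bigr => z _ /=.
by rewrite mulKg invMg mulrA mulgA.
Qed.

Lemma zgmul1l : left_id (zgelt 1%g) zgmul.
Proof.
move=> a; apply/ffunP=> x; rewrite ffunE (bigD1 1%g) //= ffunE eqxx mul1r.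
rewrite invg1 mul1g big1 ?addr0 // => y /negPf y_neq1.
by rewrite ffunE y_neq1 mul0r.
Qed.

Lemma zgmul1r : right_id (zgelt 1%g) zgmul.
Proof.
move=> a; apply/ffunP=> x; rewrite ffunE (bigD1 x) //= ffunE mulVg eqxx mulr1.
rewrite big1 ?addr0 // => y y_neqx; rewrite ffunE -eq_mulVg1.
by rewrite (negPf y_neqx) mulr0.
Qed.

Lemma zgmulDl : left_distributive zgmul +%R.
Proof.
move=> a b c; apply/ffunP=> x; rewrite !ffunE -big_split /=.
by apply: eq_bigr => y _; rewrite ffunE mulrDl.
Qed.

Lemma zgmulDr : right_distributive zgmul +%R.
Proof.
move=> a b c; apply/ffunP=> x; rewrite !ffunE -big_split /=.
by apply: eq_bigr => y _; rewrite ffunE mulrDr.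
Qed.

Lemma zgelt1_neq0 : zgelt 1%g != 0.
Proof. by apply/eqP => /ffunP/(_ 1%g); rewrite !ffunE eqxx. Qed.

HB.instance Definition _ := GRing.Zmodule_isNzRing.Build (zgring gT)
  zgmulA zgmul1l zgmul1r zgmulDl zgmulDr zgelt1_neq0.

Definition set_sum (X : {set gT}) : zgring gT := \sum_(x in X) zgelt x.

Definition in_zspan (P : {set {set gT}}) (a : zgring gT) : Prop :=
  exists c : {set gT} -> int, a = \sum_(X in P) set_sum X *~ c X.

(* X^-1 is the pointwise inverse of the set X.                                *)
Definition is_Sring (A : {pred zgring gT}) : Prop :=
  subring_closed A /\
  exists P : {set {set gT}},
    [/\ partition P [set: gT],
        [set 1%g] \in P,
        forall X : {set gT}, X \in P -> (X^-1)%g \in P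
      & forall a : zgring gT, a \in A <-> in_zspan P a].

(* The group G_r of the permutations x |-> x * g.                             *)
Definition right_translations : {group {perm gT}} :=
  (actperm 'R @* [set: gT])%G.

Definition stab1_orbits (K : {group {perm gT}}) : {set {set gT}} :=
  orbit 'P 'C_K[1%g | 'P] @: [set: gT].

(* V(K, G), also called the transitivity module of K over G.                  *)
Definition in_transitivity_module (K : {group {perm gT}}) : zgring gT -> Prop :=
  in_zspan (stab1_orbits K).

Definition schurian (A : {pred zgring gT}) : Prop :=
  exists2 K : {group {perm gT}}, right_translations \subset K &
    forall a : zgring gT, a \in A <-> in_transitivity_module K a.

End GroupRing.

Definition Schur_group (gT : finGroupType) : Prop :=
  forall A : {pred zgring gT}, is_Sring A -> schurian A.

(* Main.v *)
(* An S-ring over the dihedral group is a colouring [k] of the pairs          *)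
(* [(b, i) = s ^ b * r ^ i] whose class functions, viewed as pairs (rotation  *)
(* part, reflection part) over Z[C_p], form a ring; it is schurian as soon as *)
(* the stabilizer of 1 in its automorphism group is transitive on classes.    *)
(*   If some class mixes rotations and reflections, every class but {1} does  *)
(* or consists of reflections. The sign character then occurs in the          *)
(* representations of degree 2, which gives (X + m)^2 = Y conj(Y) for each    *)
(* class (X, Y), with m = |Y| - |X|. Hence the S-ring is trivial, or has a    *)
(* class {s'} with s' a reflection and is a wreath product over {1, s'}.      *)
(*   Otherwise the classes of rotations are 1 and the cosets of a subgroup M  *)
(* of F_p^* (Schur's multiplier theorem). Either the reflections form one     *)
(* class, or there are as many classes of reflections as of rotations and the *)
(* products of their sizes are divisible by m = |M|. For a prime power m, and *)
(* so for a Fermat prime p, this forces a class with one element, and the     *)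
(* S-ring is cyclotomic. For p = 4q + 1 the cases m = 2q and m = 4q remain.   *)
(* The first one, with sizes q, q + 1, 2q, contradicts the norm of the        *)
(* quadratic Gauss sum. In the second one a class is a difference set with q  *)
(* or q + 1 elements; every prime divisor of its order n has order q mod p,   *)
(* so all quartic residues are multipliers, and the set consists, up to an    *)
(* affine map, of the quartic residues and possibly 0. The quartic Gauss sums *)
(* give p = 1 + 4c^2 or p = 9 + 4c^2, whence q = 3: this is the projective    *)
(* plane of order 3, whose collineations are listed explicitly.               *)
Require Import Defs.
From HB Require Import structures.
From mathcomp Require Import all_boot all_order all_algebra all_fingroup.
From mathcomp Require Import all_solvable all_field.
From mathcomp Require Import zify ring.

Set Implicit Arguments.
Unset Strict Implicit.
Unset Printing Implicit Defensive.

Import Order.TTheory GRing.Theory Num.Theory.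
Local Open Scope ring_scope.

(** The classes of an S-ring colour the elements s^b r^i of the dihedral group, and closure under
    inverse and product becomes a statement on pairs over Z[C_p] ([Scoloring_pcolor]). By
    [schurian_pcolor] it remains to find, for two elements of one class, an automorphism of the
    colouring that fixes 1 and moves one to the other. Suppose some class mixes rotations and
    reflections. A dimension count and the absence of zero divisors in Z[C_p] / (J) ([cg_mul_eq0])
    give the equation [norm_eq0]. Its constant term shows that a class other than {1} has 0 or 1
    more reflections than rotations, and exactly one has 1 more ([special_color]). Then
    [mixed_structure] leaves the trivial S-ring or a wreath product, which have enough automorphisms
    ([mixed_color_schurian]). Otherwise Frobenius congruences ([multiplier]) make the classes of
    nontrivial rotations the cosets of a subgroup M of F_p^*, of order m. If the reflections form
    one class, automorphisms are easily found ([pure_constant_schurian]). If not, with p = r m + 1,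
    there are r + 1 classes of reflections, and m divides the product of any two distinct sizes
    ([pure_sizes]). A class with a single reflection copies the structure of the rotations
    ([pure_point_schurian]). Such a class exists when m is a prime power ([prime_power_size1]),
    which settles Fermat primes. For p = 4q + 1 this leaves m = 2q and m = 4q. In the first case the
    sizes are q, q + 1, 2q, and the square of the quadratic Gauss sum excludes them ([no_sizes_2q]).
    In the second, one of two classes is a difference set with q or q + 1 elements; the multiplier
    theorem ([diffset_multiplier]) reduces it to the quartic residues with or without 0, and
    [quartic_equation] leaves q = 3, where [color13_schurian] exhibits collineations. *)

(** * The group ring of the cyclic group of order p *)

(* Z[C_p] as the convolution ring of functions on ('F_p, +): [cgd i] is the   *)
(* group element [r ^ i], [act t] the automorphism [r ^ i |-> r ^ (t * i)],   *)
(* and [cgJ] the sum of all group elements.                                   *)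
Definition cgr (p : nat) : Type := {ffun 'F_p -> int}.

HB.instance Definition _ (p : nat) :=
  GRing.Zmodule.copy (cgr p) {ffun 'F_p -> int}.

Section CyclicGroupRing.

Variable p : nat.
Implicit Types (x y z : cgr p) (i j t : 'F_p).

Definition cgd i : cgr p := [ffun j => (j == i)%:R].

Definition cgmul x y : cgr p := [ffun i => \sum_j x j * y (i - j)].

Lemma cgmulA : associative cgmul.
Proof.
move=> x y z; apply/ffunP=> i; rewrite !ffunE.
under eq_bigr do rewrite ffunE mulr_sumr.
under [RHS]eq_bigr do rewrite ffunE mulr_suml.
rewrite [RHS]exchange_big; apply: eq_bigr => j _ /=.
rewrite [RHS](reindex_inj (addrI j)); apply: eq_bigr => k _ /=.
by rewrite [j + k]addrC addrK mulrA opprD [- k - j]addrC addrA.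
Qed.

Lemma cgmulC : commutative cgmul.
Proof.
move=> x y; apply/ffunP=> i; rewrite !ffunE.
rewrite (reindex_inj (inv_inj (subKr i))) /=.
by apply: eq_bigr => j _; rewrite subKr mulrC.
Qed.

Lemma cgmul1 : left_id (cgd 0) cgmul.
Proof.
move=> x; apply/ffunP=> i; rewrite ffunE (bigD1 0) //= ffunE eqxx mul1r subr0.
by rewrite big1 ?addr0 // => j /negPf jN0; rewrite ffunE jN0 mul0r.
Qed.

Lemma cgmulDl : left_distributive cgmul +%R.
Proof.
move=> x y z; apply/ffunP=> i; rewrite !ffunE -big_split /=.
by apply: eq_bigr => j _; rewrite ffunE mulrDl.
Qed.

Lemma cgd0_neq0 : cgd 0 != 0.
Proof. by apply/eqP => /ffunP/(_ 0); rewrite !ffunE eqxx. Qed.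

HB.instance Definition _ := GRing.Zmodule_isComNzRing.Build (cgr p)
  cgmulA cgmulC cgmul1 cgmulDl cgd0_neq0.

Lemma cgM x y i : (x * y) i = \sum_j x j * y (i - j).
Proof. exact: ffunE. Qed.

Lemma cgD x y i : (x + y) i = x i + y i.
Proof. exact: ffunE. Qed.

Lemma cgN x i : (- x) i = - x i.
Proof. exact: ffunE. Qed.

Lemma cg0 i : (0 : cgr p) i = 0.
Proof. exact: ffunE. Qed.

Lemma cgB x y i : (x - y) i = x i - y i.
Proof. by rewrite cgD cgN. Qed.

Lemma cg1 i : (1 : cgr p) i = (i == 0)%:R.
Proof. exact: ffunE. Qed.

Lemma cgMn x n i : (x *+ n) i = x i *+ n.
Proof. by elim: n => [|n IHn]; rewrite ?cg0 // !mulrS cgD IHn. Qed.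

Lemma cgMz x (n : int) i : (x *~ n) i = x i * n.
Proof.
case: n => n; first by rewrite -pmulrn cgMn -mulr_natr natz.
by rewrite NegzE mulrNz cgN -pmulrn cgMn -mulr_natr natz mulrN.
Qed.

Lemma cg_sum (I : Type) (r : seq I) (P : pred I) (f : I -> cgr p) i :
  (\sum_(k <- r | P k) f k) i = \sum_(k <- r | P k) f k i.
Proof. by elim/big_rec2: _ => [|k u v _ <-]; rewrite ?cg0 ?cgD. Qed.

Lemma cgint (n : int) i : (n%:~R : cgr p) i = (i == 0)%:R * n.
Proof. by rewrite -[n%:~R]/(1 *~ n) cgMz cg1. Qed.

Lemma cgdM i x j : (cgd i * x) j = x (j - i).
Proof.
rewrite cgM (bigD1 i) //= ffunE eqxx mul1r big1 ?addr0 // => k /negPf kNi.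
by rewrite ffunE kNi mul0r.
Qed.

Lemma cgdD i j : cgd (i + j) = cgd i * cgd j.
Proof. by apply/ffunP=> k; rewrite cgdM !ffunE subr_eq addrC. Qed.

Lemma cgd0 : cgd 0 = 1.
Proof. by []. Qed.

Lemma cgdX i n : cgd i ^+ n = cgd (i *+ n).
Proof. by elim: n => [|n IHn]; rewrite ?cgd0 // exprS mulrS cgdD IHn. Qed.

Lemma cg_expand x : x = \sum_i cgd i *~ x i.
Proof.
apply/ffunP=> j; rewrite cg_sum (bigD1 j) //= cgMz ffunE eqxx mul1r.
by rewrite big1 ?addr0 // => i; rewrite cgMz ffunE eq_sym => /negPf->; rewrite mul0r.
Qed.

Definition act t x : cgr p := [ffun i => x (t^-1 * i)].

Lemma actE t x i : act t x i = x (t^-1 * i).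
Proof. exact: ffunE. Qed.

Lemma actD t x y : act t (x + y) = act t x + act t y.
Proof. by apply/ffunP=> i; rewrite !(cgD, actE). Qed.

Lemma actN t x : act t (- x) = - act t x.
Proof. by apply/ffunP=> i; rewrite !(cgN, actE). Qed.

Lemma actB t x y : act t (x - y) = act t x - act t y.
Proof. by rewrite actD actN. Qed.

Lemma actMz t x (n : int) : act t (x *~ n) = act t x *~ n.
Proof. by apply/ffunP=> i; rewrite !(cgMz, actE). Qed.

Lemma actMn t x n : act t (x *+ n) = act t x *+ n.
Proof. by apply/ffunP=> i; rewrite !(cgMn, actE). Qed.

Lemma act1l x : act 1 x = x.
Proof. by apply/ffunP=> i; rewrite actE invr1 mul1r. Qed.

Lemma act_act t u x : act t (act u x) = act (t * u) x.
Proof. by apply/ffunP=> i; rewrite !actE invfM mulrA (mulrC u^-1). Qed.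

Section ActUnit.
Variables (t : 'F_p) (t_neq0 : t != 0).

Lemma actM x y : act t (x * y) = act t x * act t y.
Proof.
apply/ffunP=> i; rewrite actE !cgM [RHS](reindex_inj (mulfI t_neq0)) /=.
by apply: eq_bigr => j _; rewrite !actE mulKf // mulrBr mulKf.
Qed.

Lemma actd i : act t (cgd i) = cgd (t * i).
Proof.
by apply/ffunP=> j; rewrite actE !ffunE (can2_eq (mulVKf t_neq0) (mulKf t_neq0)).
Qed.

Lemma act1 : act t 1 = 1.
Proof. by rewrite -cgd0 actd mulr0. Qed.

Lemma actX x n : act t (x ^+ n) = act t x ^+ n.
Proof. by elim: n => [|n IHn]; rewrite ?act1 // !exprS actM IHn. Qed.

Lemma act_int (n : int) : act t n%:~R = n%:~R.
Proof. by rewrite -[n%:~R]/(1 *~ n) actMz act1. Qed.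

End ActUnit.

Definition conj x := act (-1) x.

Lemma conjE x i : conj x i = x (- i).
Proof. by rewrite actE invrN1 mulN1r. Qed.

Lemma oppr1_neq0 : (-1 : 'F_p) != 0.
Proof. by rewrite oppr_eq0 oner_eq0. Qed.

Lemma conjM x y : conj (x * y) = conj x * conj y.
Proof. exact: (actM oppr1_neq0). Qed.

Lemma conjK x : conj (conj x) = x.
Proof. by apply/ffunP=> i; rewrite !conjE opprK. Qed.

Lemma conjM0 x y : (conj x * y) 0 = \sum_i x i * y i.
Proof.
rewrite cgM (reindex_inj oppr_inj); apply: eq_bigr => i _ /=.
by rewrite conjE !opprK add0r.
Qed.

Lemma cgM_conj x y i : (conj x * y) i = \sum_j x j * y (i + j).
Proof.
rewrite cgM (reindex_inj oppr_inj); apply: eq_bigr => j _ /=.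
by rewrite conjE !opprK.
Qed.

Definition aug x := \sum_i x i.

Lemma augD x y : aug (x + y) = aug x + aug y.
Proof. by rewrite /aug -big_split; apply: eq_bigr => i _; rewrite cgD. Qed.

Lemma augN x : aug (- x) = - aug x.
Proof. by rewrite /aug -sumrN; apply: eq_bigr => i _; rewrite cgN. Qed.

Lemma augB x y : aug (x - y) = aug x - aug y.
Proof. by rewrite augD augN. Qed.

Lemma augMz x (n : int) : aug (x *~ n) = aug x * n.
Proof. by rewrite /aug mulr_suml; apply: eq_bigr => i _; rewrite cgMz. Qed.

Lemma augM x y : aug (x * y) = aug x * aug y.
Proof.
rewrite /aug; under eq_bigr do rewrite cgM.
rewrite exchange_big mulr_suml; apply: eq_bigr => j _ /=.
rewrite -mulr_sumr; congr (_ * _).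
by rewrite (reindex_inj (addrI j)); apply: eq_bigr => i _; rewrite addrC addKr.
Qed.

Lemma augd i : aug (cgd i) = 1.
Proof.
rewrite /aug (bigD1 i) //= ffunE eqxx big1 ?addr0 // => j /negPf jNi.
by rewrite ffunE jNi.
Qed.

Lemma aug1 : aug 1 = 1.
Proof. exact: augd. Qed.

Lemma aug_int (n : int) : aug n%:~R = n.
Proof. by rewrite -[n%:~R]/(1 *~ n) augMz aug1 mul1r. Qed.

Lemma aug_act t x : t != 0 -> aug (act t x) = aug x.
Proof.
move=> tN0; rewrite /aug (reindex_inj (mulfI tN0)); apply: eq_bigr => i _ /=.
by rewrite actE mulKf.
Qed.

Lemma aug_conj x : aug (conj x) = aug x.
Proof. exact: (aug_act _ oppr1_neq0). Qed.

Definition cgJ : cgr p := [ffun=> 1].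

Lemma cgJE i : cgJ i = 1.
Proof. exact: ffunE. Qed.

Lemma cgJM x : cgJ * x = cgJ *~ aug x.
Proof.
apply/ffunP=> i; rewrite mulrC cgM cgMz cgJE mul1r; apply: eq_bigr => j _.
by rewrite cgJE mulr1.
Qed.

Lemma actJ t : act t cgJ = cgJ.
Proof. by apply/ffunP=> i; rewrite actE !cgJE. Qed.

Lemma augJ : prime p -> aug cgJ = p%:Z.
Proof.
move=> p_pr; rewrite /aug; under eq_bigr do rewrite cgJE.
by rewrite sumr_const card_Fp // natz.
Qed.

Definition ind (S : {set 'F_p}) : cgr p := [ffun i => (i \in S)%:R].

Lemma indE S i : ind S i = (i \in S)%:R.
Proof. exact: ffunE. Qed.

Lemma aug_ind S : aug (ind S) = #|S|%:Z.
Proof.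
rewrite /aug; under eq_bigr do rewrite indE.
rewrite -[RHS]natz -sumr_const [RHS]big_mkcond.
by apply: eq_bigr => i _; case: (i \in S).
Qed.

End CyclicGroupRing.

Arguments cgJ {p}.
Arguments cgd {p} i.

(** * Integral dependence, congruences and multipliers *)

(** A matrix with more rows than columns has a nonzero left kernel over the rationals; clearing
    denominators makes the relation integral. It turns a count of classes into a nonzero class
    function killed by a multiplication. *)
Lemma int_dep (T1 T2 : finType) (A : {set T1}) (B : {set T2})
    (M : T1 -> T2 -> int) : (#|B| < #|A|)%N ->
  exists h : T1 -> int, (exists2 i, i \in A & h i != 0) /\
    forall j, j \in B -> \sum_(i in A) h i * M i j = 0.
Proof.
move=> ltBA.
pose Q := \matrix_(i < #|A|, j < #|B|) ((M (enum_val i) (enum_val j))%:~R : rat).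
have: kermx Q != 0.
  rewrite -mxrank_eq0 mxrank_ker subn_eq0 -ltnNge.
  exact: leq_ltn_trans (rank_leq_col _) ltBA.
case/rowV0Pn=> u; move/sub_kermxP=> uQ0 uN0.
have [k ukN0] : exists k, u 0 k != 0 by apply/rV0Pn.
pose d := \prod_k denq (u 0 k).
have dN0 : d%:~R != 0 :> rat.
  by rewrite intr_eq0; apply/prodf_neq0 => i _; apply: denq_neq0.
pose g k := numq (u 0 k * d%:~R).
have gE l : (g l)%:~R = u 0 l * d%:~R.
  rewrite /g /d (bigD1 l) //= intrM mulrA.
  have -> : u 0 l * (denq (u 0 l))%:~R = (numq (u 0 l))%:~R.
    by rewrite -{1}(divq_num_den (u 0 l)) mulfVK // intr_eq0 denq_neq0.
  by rewrite -intrM numq_int.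
have Ak : enum_val k \in A by apply: enum_valP.
exists (fun i => g (enum_rank_in Ak i)); split.
  exists (enum_val k) => //; rewrite enum_valK_in -(intr_eq0 rat) gE.
  by rewrite mulf_eq0 negb_or ukN0.
move=> j Bj; apply/eqP; rewrite -(intr_eq0 rat) rmorph_sum /=; apply/eqP.
rewrite big_enum_val /=.
have: (u *m Q) 0 (enum_rank_in Bj j) = 0 by rewrite uQ0 mxE.
rewrite mxE => /(congr1 ( *%R^~ d%:~R)); rewrite mul0r mulr_suml => uQd.
rewrite -[RHS]uQd; apply: eq_bigr => i _; rewrite enum_valK_in intrM gE mxE enum_rankK_in //.
by rewrite mulrAC.
Qed.

Section RingDivisibility.

Variable R : comNzRingType.
Implicit Types (a b c : R) (n : nat).

Definition dvdr n a := exists c, a = c *+ n.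

Lemma dvdr0 n : dvdr n 0.
Proof. by exists 0; rewrite mul0rn. Qed.

Lemma dvdrD n a b : dvdr n a -> dvdr n b -> dvdr n (a + b).
Proof. by case=> c -> [d ->]; exists (c + d); rewrite mulrnDl. Qed.

Lemma dvdrN n a : dvdr n a -> dvdr n (- a).
Proof. by case=> c ->; exists (- c); rewrite mulNrn. Qed.

Lemma dvdrB n a b : dvdr n a -> dvdr n b -> dvdr n (a - b).
Proof. by move=> na /dvdrN; apply: dvdrD. Qed.

Lemma dvdrMl n a b : dvdr n b -> dvdr n (a * b).
Proof. by case=> c ->; exists (a * c); rewrite mulrnAr. Qed.

Lemma dvdrMr n a b : dvdr n a -> dvdr n (a * b).
Proof. by rewrite mulrC; apply: dvdrMl. Qed.

Lemma dvdrMM m n a b : dvdr m a -> dvdr n b -> dvdr (m * n) (a * b).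
Proof.
by case=> c -> [d ->]; exists (c * d); rewrite mulrnAr mulrnAl -mulrnA.
Qed.

Lemma dvdr_nat m n a : (m %| n)%N -> dvdr n a -> dvdr m a.
Proof. by case/dvdnP=> k -> [c ->]; exists (c *+ k); rewrite mulrnA. Qed.

Lemma dvdr_sum n (I : Type) (r : seq I) (P : pred I) (F : I -> R) :
  (forall i, P i -> dvdr n (F i)) -> dvdr n (\sum_(i <- r | P i) F i).
Proof. by move=> nF; apply: big_ind => //; [apply: dvdr0 | apply: dvdrD]. Qed.

Lemma dvdrBX n a b m : dvdr n (a - b) -> dvdr n (a ^+ m - b ^+ m).
Proof. by rewrite subrXX => /dvdrMr. Qed.

Lemma dvdr_expD l a b : prime l -> dvdr l ((a + b) ^+ l - (a ^+ l + b ^+ l)).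
Proof.
move=> l_pr; have l_gt0 := prime_gt0 l_pr.
rewrite exprDn -(prednK l_gt0) big_ord_recr big_ord_recl /= prednK //.
rewrite bin0 subn0 expr0 mulr1 subnn expr0 mul1r binn !mulr1n.
set s := \sum_(i < _) _; have -> : a ^+ l + s + b ^+ l - (a ^+ l + b ^+ l) = s by ring.
apply: dvdr_sum => i _; exists (a ^+ (l - bump 0 i) * b ^+ bump 0 i *+ ('C(l, bump 0 i) %/ l)).
rewrite -mulrnA divnK // prime_dvd_bin // /bump /= add1n /=.
by have := ltn_ord i; lia.
Qed.

(** Each further [l]-th power gains a factor [l]: u^l - v^l is u - v times a sum which is congruent
    to l v^(l-1), hence to 0, mod [l]. *)
Lemma dvdr_lift l k a b : prime l ->
  dvdr l (a - b) -> dvdr (l ^ k.+1) (a ^+ (l ^ k) - b ^+ (l ^ k)).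
Proof.
move=> l_pr lab; elim: k => [|k IHk]; first by rewrite expn1 expn0 !expr1.
have powS (c : R) : c ^+ (l ^ k.+1) = (c ^+ (l ^ k)) ^+ l by rewrite expnSr exprM.
rewrite [(l ^ k.+2)%N]expnSr !powS.
set u := a ^+ _ in IHk *; set v := b ^+ _ in IHk *.
have luv : dvdr l (u - v) by apply: dvdr_nat IHk; rewrite expnS dvdn_mulr.
rewrite subrXX; apply: dvdrMM => //.
have -> : \sum_(i < l) u ^+ (l.-1 - i) * v ^+ i =
    \sum_(i < l) (u ^+ (l.-1 - i) - v ^+ (l.-1 - i)) * v ^+ i + v ^+ l.-1 *+ l.
  have -> : v ^+ l.-1 *+ l = \sum_(i < l) v ^+ (l.-1 - i) * v ^+ i.
    rewrite -{2}(card_ord l) -sumr_const; apply: eq_bigr => i _.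
    by rewrite -exprD subnK //; have := ltn_ord i; lia.
  by rewrite -big_split; apply: eq_bigr => i _ /=; rewrite mulrBl subrK.
apply: dvdrD; last by exists (v ^+ l.-1).
by apply: dvdr_sum => i _; apply/dvdrMr/dvdrBX.
Qed.

End RingDivisibility.

Lemma dvdr_cg p n (x : cgr p) i : dvdr n x -> dvdr n (x i).
Proof. by case=> c ->; exists (c i); rewrite cgMn. Qed.

Lemma dvdr_act p n (x : cgr p) t : dvdr n x -> dvdr n (act t x).
Proof. by case=> c ->; exists (act t c); rewrite !pmulrn actMz. Qed.

Lemma dvdr_int n (a : int) : dvdr n a <-> (n %| a)%Z.
Proof.
split=> [[c ->]|/dvdzP[c ->]]; first by rewrite -mulr_natr natz dvdz_mull.
by exists c; rewrite -mulr_natr natz.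
Qed.

Section PrimeOrder.

Variables (p : nat) (p_pr : prime p).
Implicit Types x y : cgr p.

(** Raising to the power [l] is additive mod [l] and sends [cgd i] to [cgd (l i)], so it agrees with
    [act l] on the additive span of the group elements. *)
Lemma frobenius x l : prime l -> l%:R != 0 :> 'F_p ->
  dvdr l (x ^+ l - act l%:R x).
Proof.
move=> l_pr lN0; pose Q x := dvdr l (x ^+ l - act l%:R x).
have QD y z : Q y -> Q z -> Q (y + z).
  move=> Qy Qz; have := dvdrD (dvdr_expD y z l_pr) (dvdrD Qy Qz).
  by rewrite /Q actD; congr dvdr; ring.
have QN y : Q y -> Q (- y).
  move=> Qy; have := dvdrB (dvdrN (dvdr_expD y (- y) l_pr)) Qy.
  rewrite /Q actN subrr expr0n gtn_eqF ?prime_gt0 //=; congr dvdr; ring.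
have Q0 : Q 0.
  rewrite /Q expr0n gtn_eqF ?prime_gt0 //.
  by rewrite sub0r; apply/dvdrN; exists 0; apply/ffunP=> i; rewrite actE mul0rn !cg0.
have Qd i : Q (cgd i).
  by rewrite /Q cgdX actd // mulr_natl subrr; apply: dvdr0.
rewrite -/(Q x) [x]cg_expand; apply: big_ind => // i _.
have Qn n : Q (cgd i *+ n) by elim: n => // n IHn; rewrite mulrS; apply: QD.
by case: (x i) => n; rewrite ?NegzE ?mulrNz; [|apply: QN]; rewrite -pmulrn.
Qed.

Lemma big_Fp (R : Type) (idx : R) (op : R -> R -> R) (f : 'F_p -> R) :
  \big[op/idx]_(i : 'F_p) f i = \big[op/idx]_(0 <= i < p) f i%:R.
Proof.
have -> : \big[op/idx]_(i : 'F_p) f i = \big[op/idx]_(i : 'F_p) f (i : nat)%:R.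
  by apply: eq_bigr => i _; rewrite natr_Zp.
by rewrite -(big_mkord predT (fun i => f i%:R)) Fp_cast.
Qed.

Lemma Fp_ord_neq0 i : (0 < i < p)%N -> i%:R != 0 :> 'F_p.
Proof.
case/andP=> i_gt0 ltip; apply: contraTneq ltip => /(congr1 val) /=.
by rewrite val_Fp_nat // => /eqP; rewrite -[_ == _]/(p %| i)%N -leqNgt; apply: dvdn_leq.
Qed.

(* Z[C_p] / (J) is the ring of integers of the p-th cyclotomic field, hence a *)
(* domain.                                                                    *)
Lemma cg_mul_eq0 x y : x * y = 0 ->
  (exists c, x = cgJ *~ c) \/ (exists c, y = cgJ *~ c).
Proof.
move=> xy0; have [z z_prim] := C_prim_root_exists (prime_gt0 p_pr).
pose phi (u : cgr p) : algC := \sum_(i : 'F_p) (u i)%:~R * z ^+ i.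
have zD (i j : 'F_p) : z ^+ (i + j)%R = z ^+ i * z ^+ j.
  rewrite -exprD -(prim_expr_mod z_prim (_ + _)).
  by congr (_ ^+ _); rewrite /=; congr (_ %% _)%N; apply: Fp_cast.
have phiM u v : phi (u * v) = phi u * phi v.
  rewrite /phi mulr_suml; under eq_bigr do rewrite cgM rmorph_sum mulr_suml /=.
  rewrite exchange_big; apply: eq_bigr => j _ /=; rewrite mulr_sumr.
  rewrite (reindex_inj (addrI j)); apply: eq_bigr => i _ /=.
  by rewrite [(j + i)%R]addrC addrK zD intrM; ring.
have z_sum : \sum_(i : 'F_p) z ^+ i = 0.
  set s := \sum_i _; have: (z - 1) * s = 0.
    rewrite mulrBl mul1r; apply/eqP; rewrite subr_eq0; apply/eqP.
    rewrite /s mulr_sumr [RHS](reindex_inj (addIr 1)); apply: eq_bigr => i _.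
    rewrite zD mulrC; congr (_ * _).
  move/eqP; rewrite mulf_eq0 subr_eq0 => /orP[/eqP z1|/eqP//].
  have := prim_order_dvd z_prim 1; rewrite expr1 z1 eqxx dvdn1 => /eqP p1.
  by move: p_pr; rewrite p1.
have phi0 u : phi u = 0 -> exists c, u = cgJ *~ c.
  move=> phiu0; pose c := u p.-1%:R; exists c.
  (* Subtracting the last coefficient everywhere leaves [phi u] unchanged, since the powers of z sum
     to 0. The resulting polynomial vanishes at z and is too short to be a nonzero multiple of the
     cyclotomic polynomial. *)
  pose q := \poly_(i < p.-1) ((u i%:R - c)%:~R : rat).
  have [m [mz m_monic] rootm] := minCpolyP z.
  have size_m : size m = p.
    have := size_cyclotomic z p; rewrite -(minCpoly_cyclotomic z_prim) mz.
    by rewrite size_map_poly totient_prime // prednK ?prime_gt0.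
  have q0 : q = 0.
    have: root (map_poly ratr q) z.
      apply/eqP; transitivity (phi u - c%:~R * \sum_(i : 'F_p) z ^+ i); last first.
        by rewrite phiu0 z_sum mulr0 subr0.
      rewrite /phi mulr_sumr -sumrB (big_Fp _ _ (fun i : 'F_p => (u i)%:~R * z ^+ i - c%:~R * z ^+ i)).
      rewrite -[X in \sum_(0 <= i < X) _](prednK (prime_gt0 p_pr)) big_nat_recr //=.
      rewrite subrr addr0 big_mkord (@horner_coef_wide _ p.-1); last first.
        by rewrite size_map_poly size_poly.
      apply: eq_bigr => i _; rewrite coef_map coef_poly ltn_ord /= ratr_int.
      rewrite intrB mulrBl val_Fp_nat // modn_small //.
      by have := ltn_ord i; lia.
    rewrite rootm => /dvdp_leq; rewrite size_m; case: eqP => // _ /(_ isT).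
    move=> /leq_trans/(_ (size_poly _ _)); have := prime_gt0 p_pr; lia.
  apply/ffunP=> i; rewrite cgMz cgJE mul1r.
  have [ltip|] := ltnP i p.-1.
    move/polyP/(_ i): q0; rewrite coef_poly ltip coef0 natr_Zp => /eqP.
    by rewrite intr_eq0 subr_eq0 => /eqP.
  move=> lepi; rewrite /c; congr (u _); apply: val_inj => /=.
  have ltip : (i < p)%N by have := ltn_ord i; rewrite [X in (_ < X)%N]Fp_cast.
  rewrite val_Fp_nat // modn_small; last by have := prime_gt0 p_pr; lia.
  lia.
move/(congr1 phi): xy0; rewrite phiM {3}/phi big1 => [|i _]; last by rewrite cg0 mul0r.
by move/eqP; rewrite mulf_eq0 => /orP[] /eqP /phi0; [left | right].
Qed.

Lemma mulJ_eq0 c : cgJ *~ c = 0 :> cgr p -> c = 0.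
Proof. by move/ffunP/(_ 0); rewrite cgMz cgJE cg0 mul1r. Qed.

Section Multipliers.

Variables (T : eqType) (c : 'F_p -> T).

Definition class_fun x := forall i j, c i = c j -> x i = x j.

Hypothesis class_funM : forall x y, class_fun x -> class_fun y -> class_fun (x * y).

(* Modulo [l], the class function [x ^ l] is congruent to [act l x].          *)
Lemma multiplier_prime l i j : prime l -> l%:R != 0 :> 'F_p ->
  c i = c j -> c (l%:R^-1 * i) = c (l%:R^-1 * j).
Proof.
move=> l_pr lN0 cij; pose x := ind [set k | c k == c (l%:R^-1 * i)].
have cx : class_fun x by move=> k m ckm; rewrite !indE !inE ckm.
have cxl : class_fun (x ^+ l).
  rewrite -(prednK (prime_gt0 l_pr)); elim: l.-1 => [|n IHn]; first by rewrite expr1.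
  by rewrite exprS; apply: class_funM.
have := dvdrB (dvdr_cg i (frobenius x l_pr lN0)) (dvdr_cg j (frobenius x l_pr lN0)).
rewrite !cgB (cxl _ _ cij) !actE !indE !inE eqxx => /dvdr_int.
case: eqP => // _; have := prime_gt1 l_pr.
have -> : (x ^+ l) j - 1 - ((x ^+ l) j - false%:R) = - 1%:Z by lia.
by rewrite dvdzE abszN dvdn1 => l_gt1 /eqP; lia.
Qed.

(** A nonzero residue is represented by a positive integer below [p], a product of primes other than
    [p]; the induction splits off its smallest prime factor. *)
Lemma multiplier t i j : c i = c j -> c (t * i) = c (t * j).
Proof.
suff inv n : (0 < n < p)%N -> forall i j, c i = c j -> c (n%:R^-1 * i) = c (n%:R^-1 * j).
  have [->|tN0] := eqVneq t 0; first by rewrite !mul0r.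
  rewrite -[t]invrK -[t^-1]natr_Zp; apply: inv.
  have: t^-1 != 0 by rewrite invr_eq0.
  have := ltn_ord t^-1; rewrite [X in (_ < X)%N]Fp_cast // => -> .
  by rewrite andbT lt0n; apply: contra => /eqP t0; apply/eqP/val_inj.
elim/ltn_ind: n => n IHn /andP[n_gt0 ltnp] {}i {}j cij.
have [n1|n_gt1] := leqP n 1.
  have -> : n = 1%N by lia.
  by rewrite invr1 !mul1r.
have l_pr := pdiv_prime n_gt1; set l := pdiv n in l_pr.
have l_gt1 := prime_gt1 l_pr.
have def_n : n = ((n %/ l) * l)%N by rewrite divnK // pdiv_dvd.
have ltln : (n %/ l < n)%N by apply: ltn_Pdiv.
have m_gt0 : (0 < n %/ l)%N by rewrite divn_gt0 ?prime_gt0 // dvdn_leq ?pdiv_dvd.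
rewrite def_n mulnC natrM invfM -!mulrA; apply: multiplier_prime => //.
  by apply: Fp_ord_neq0; rewrite prime_gt0 //= (leq_ltn_trans _ ltnp) // dvdn_leq // pdiv_dvd.
by apply: IHn => //; rewrite m_gt0 (ltn_trans ltln).
Qed.

End Multipliers.

End PrimeOrder.

(** * S-rings over the dihedral group as colourings *)

(* The pair [(b, i)] stands for [s ^ b * r ^ i], where [r] generates the     *)
(* rotations and [s] is a reflection.                                         *)
Definition dih (p : nat) : Type := (bool * 'F_p)%type.

HB.instance Definition _ (p : nat) := Finite.copy (dih p) (bool * 'F_p)%type.

Definition dmul p (u v : dih p) : dih p :=
  (u.1 (+) v.1, (if v.1 then - u.2 else u.2) + v.2).

Definition dinv p (u : dih p) : dih p := if u.1 then u else (false, - u.2).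

Definition ddiv p (u v : dih p) : dih p := dmul u (dinv v).

Definition d1 p : dih p := (false, 0).

Lemma ddivE p (u v : dih p) :
  ddiv u v = (u.1 (+) v.1, if v.1 then v.2 - u.2 else u.2 - v.2).
Proof. by case: u v => [[] i] [[] j]; rewrite /ddiv /dmul /= // addrC. Qed.

Lemma ddivvv p (u : dih p) : ddiv u u = d1 p.
Proof. by case: u => [[] i]; rewrite ddivE /= subrr. Qed.

Lemma ddiv_eq1 p (u v : dih p) : ddiv u v = d1 p -> u = v.
Proof.
rewrite ddivE => E; move: (congr1 fst E) (congr1 snd E).
by case: u v {E} => [[] i] [[] j] //= _ /subr0_eq ->.
Qed.

(* A function on the group is a pair: its values on the rotations [r ^ i] and *)
(* on the reflections [s * r ^ i].                                            *)
Definition pv p (x y : cgr p) (u : dih p) : int := if u.1 then y u.2 else x u.2.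

Definition pair_class_fun p (T : eqType) (k : dih p -> T) (x y : cgr p) :=
  forall u v, k u = k v -> pv x y u = pv x y v.

(** The pair [(x, y)] stands for x + s y. As s inverts rotations, x s = s (conj x), which gives the
    product in [ScoloringM]; inversion fixes every reflection, hence the form of [ScoloringV]. *)
Record Scoloring p (T : eqType) (k : dih p -> T) : Prop := {
  Scoloring1 : forall u, k u = k (d1 p) -> u = d1 p;
  ScoloringV : forall x y, pair_class_fun k x y -> pair_class_fun k (conj x) y;
  ScoloringM : forall x y x' y',
    pair_class_fun k x y -> pair_class_fun k x' y' ->
    pair_class_fun k (x * x' + conj y * y') (conj x * y' + y * x') }.

Definition color_schurian p (T : eqType) (k : dih p -> T) :=
  forall u v, k u = k v -> exists f : {perm dih p},
    [/\ f (d1 p) = d1 p, f u = v &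
        forall a b, k (ddiv (f a) (f b)) = k (ddiv a b)].

Lemma trivial_color_schurian p (T : eqType) (k : dih p -> T) :
  (forall u, k u = k (d1 p) -> u = d1 p) ->
  (forall u v, u != d1 p -> v != d1 p -> k u = k v) -> color_schurian k.
Proof.
move=> k1 kN1 u v kuv; have [u1|uN1] := eqVneq u (d1 p).
  exists 1%g; split; rewrite ?perm1 //; last by move=> a b; rewrite !perm1.
  by rewrite u1 in kuv *; rewrite (k1 v).
have vN1 : v != d1 p by apply: contra uN1 => /eqP v1; rewrite (k1 u) ?kuv ?v1.
exists (tperm u v); split; rewrite ?tpermL ?tpermD //.
move=> a b; have [->|aNb] := eqVneq a b; first by rewrite !ddivvv.
apply: kN1; apply: contra aNb => /eqP/ddiv_eq1; last by move->.
by move/perm_inj->.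
Qed.

Section Coloring.

Variables (p : nat) (p_pr : prime p) (T : finType) (k : dih p -> T).
Hypothesis kS : Scoloring k.
Implicit Types (x y z : cgr p) (i j t d : 'F_p) (u v g : dih p) (c : T).

Notation cf := (pair_class_fun k).
Notation k1 := (k (d1 p)).

Definition colX c : cgr p := ind [set i | k (false, i) == c].
Definition colY c : cgr p := ind [set i | k (true, i) == c].

Lemma colXE c i : colX c i = (k (false, i) == c)%:R.
Proof. by rewrite indE inE. Qed.

Lemma colYE c i : colY c i = (k (true, i) == c)%:R.
Proof. by rewrite indE inE. Qed.

Lemma pv_col c u : pv (colX c) (colY c) u = (k u == c)%:R.
Proof. by case: u => [[] i]; rewrite /pv /= indE inE. Qed.

Lemma cf_col c : cf (colX c) (colY c).
Proof. by move=> u v kuv; rewrite !pv_col kuv. Qed.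

Lemma cf10 : cf 1 0.
Proof.
suff E u : pv 1 0 u = (k u == k1)%:R by move=> u v kuv; rewrite !E kuv.
transitivity ((u == d1 p)%:R : int); first by case: u => [[] i]; rewrite /pv /= ?cg0 ?cg1.
by congr (nat_of_bool _)%:R; apply/idP/idP => /eqP => [->|/(Scoloring1 kS)->].
Qed.

Lemma cfD x y x' y' : cf x y -> cf x' y' -> cf (x + x') (y + y').
Proof.
move=> cxy cxy' u v kuv; move: (cxy _ _ kuv) (cxy' _ _ kuv).
by rewrite /pv; case: u.1; case: v.1; rewrite !cgD => -> ->.
Qed.

Lemma cf_int (n : int) : cf n%:~R 0.
Proof.
move=> u v /cf10; rewrite /pv; case: u.1; case: v.1; rewrite ?cgint ?cg1 ?cg0 //.
  by move=> <-; rewrite mul0r.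
  by move=> ->; rewrite mul0r.
by move->.
Qed.

Lemma colX1 : colX k1 = 1.
Proof.
apply/ffunP=> i; rewrite colXE cg1; congr (nat_of_bool _)%:R.
by apply/idP/idP => /eqP => [/(Scoloring1 kS)[->]|->].
Qed.

Lemma colY1 : colY k1 = 0.
Proof.
apply/ffunP=> i; rewrite colYE cg0; case: eqP => // /(Scoloring1 kS).
by case.
Qed.

Definition colors := [set k u | u : dih p].

Lemma mem_colors u : k u \in colors.
Proof. by apply/imsetP; exists u. Qed.

Lemma sum_colX (h : T -> int) :
  \sum_(c in colors) colX c *~ h c = [ffun i => h (k (false, i))].
Proof.
apply/ffunP=> i; rewrite cg_sum ffunE (bigD1 (k (false, i))) ?mem_colors //=.
rewrite cgMz colXE eqxx mul1r big1 ?addr0 // => c /andP[_].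
by rewrite cgMz colXE eq_sym => /negPf->; rewrite mul0r.
Qed.

Lemma sum_colY (h : T -> int) :
  \sum_(c in colors) colY c *~ h c = [ffun i => h (k (true, i))].
Proof.
apply/ffunP=> i; rewrite cg_sum ffunE (bigD1 (k (true, i))) ?mem_colors //=.
rewrite cgMz colYE eqxx mul1r big1 ?addr0 // => c /andP[_].
by rewrite cgMz colYE eq_sym => /negPf->; rewrite mul0r.
Qed.

Definition rep c : dih p := odflt (d1 p) [pick u | k u == c].

Lemma repK u : k (rep (k u)) = k u.
Proof. by rewrite /rep; case: pickP => [v /eqP //|/(_ u)]; rewrite eqxx. Qed.

Lemma cf_expand x y : cf x y ->
  x = \sum_(c in colors) colX c *~ pv x y (rep c) /\
  y = \sum_(c in colors) colY c *~ pv x y (rep c).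
Proof.
move=> cxy; rewrite sum_colX sum_colY; split; apply/ffunP=> i; rewrite ffunE.
  by rewrite (cxy _ (false, i)) ?repK.
by rewrite (cxy _ (true, i)) ?repK.
Qed.

Lemma aug_sum (I : Type) (r : seq I) (P : pred I) (F : I -> cgr p) :
  aug (\sum_(i <- r | P i) F i) = \sum_(i <- r | P i) aug (F i).
Proof.
elim/big_rec2: _ => [|i a b _ <-]; last by rewrite augD.
by rewrite /aug big1 // => i _; rewrite cg0.
Qed.

Lemma conj_int (n : int) : conj n%:~R = n%:~R :> cgr p.
Proof. exact: (act_int (oppr1_neq0 p)). Qed.

Lemma conjD x y : conj (x + y) = conj x + conj y.
Proof. exact: actD. Qed.

(** * Colourings with a class that mixes rotations and reflections *)

Section Mixed.

Variables (i0 j0 : 'F_p) (mix : k (false, i0) = k (true, j0)).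

(* Otherwise the class of [r ^ i] consists of rotations, and the subgroup it  *)
(* generates, namely all rotations, would be a union of classes.              *)
Lemma rotation_mixed i : i != 0 -> exists j, k (false, i) = k (true, j).
Proof.
move=> iN0; pose c := k (false, i).
have [/existsP[j /eqP]|] := boolP [exists j, k (false, i) == k (true, j)]; first by exists j.
rewrite negb_exists => /forallP notE.
have Y0 : colY c = 0.
  by apply/ffunP=> j; rewrite colYE cg0 eq_sym (negPf (notE j)).
(* The powers of x are class functions that vanish on reflections, with non-negative coefficients,
   and x^n is positive at n i. Choosing n i = i0 contradicts [mix]. *)
pose x := 1 + colX c.
have cx : cf x 0 by rewrite -[0]addr0 -{2}Y0; apply: cfD; [apply: cf10 | apply: cf_col].
have x_ge0 j : 0 <= x j by rewrite cgD cg1 colXE; lia.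
have cxn n : cf (x ^+ n) 0.
  elim: n => [|n IHn]; first exact: cf10.
  by have := ScoloringM kS cx IHn; rewrite mulr0 mul0r mulr0 !addr0 -exprS.
have xn_ge0 n j : 0 <= (x ^+ n) j.
  elim: n j => [|n IHn] j; first by rewrite cg1; lia.
  by rewrite exprS cgM; apply: sumr_ge0 => l _; apply: mulr_ge0.
have xn_gt0 n : 1 <= (x ^+ n) (i *+ n).
  elim: n => [|n IHn]; first by rewrite cg1.
  rewrite exprS cgM (bigD1 i) //=.
  have -> : i *+ n.+1 - i = i *+ n by rewrite mulrSr addrK.
  have xi : 1 <= x i by rewrite cgD cg1 colXE eqxx; lia.
  set S := \sum_(_ | _) _; have: 0 <= S.
    by apply: sumr_ge0 => l _; apply: mulr_ge0.
  nia.
have := cxn (i^-1 * i0 : 'F_p) _ _ mix; rewrite /pv /= cg0.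
have := xn_gt0 (i^-1 * i0 : 'F_p).
by rewrite -mulr_natr natr_Zp mulVKf // => + xn0; rewrite xn0.
Qed.

(** Inversion preserves class functions and fixes every reflection, so a class containing a
    reflection is its own inverse. *)
Lemma rotation_sym i : k (false, - i) = k (false, i).
Proof.
have [->|iN0] := eqVneq i 0; first by rewrite oppr0.
have [j ij] := rotation_mixed iN0.
have := ScoloringV kS (@cf_col (k (false, i))) ij.
by rewrite /pv /= conjE colXE colYE ij eqxx; case: eqP.
Qed.

Lemma conj_cf x y : cf x y -> conj x = x.
Proof.
move=> cxy; apply/ffunP=> i; rewrite conjE.
exact: (cxy (false, - i) (false, i) (rotation_sym i)).
Qed.

Lemma color_mixed u : u != d1 p -> exists j, k u = k (true, j).
Proof.
case: u => [[] i] uN1; first by exists i.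
by apply: rotation_mixed; apply: contra uN1 => /eqP->.
Qed.

(** Minus the value at the class sum of the sign character, which is 1 on rotations and -1 on
    reflections. Adding [defect c] to the rotation part makes this character vanish. *)
Definition defect c : int := aug (colY c) - aug (colX c).

(* The sign character of the group takes the value 0 on [a = (z, y)], so      *)
(* multiplication by [a] is not injective on class functions; its kernel only *)
(* contains functions killed by the norm [z * z - conj y * y] of [a].         *)
Lemma norm_eq0 u (x := colX (k u)) (y := colY (k u)) (z := x + (defect (k u))%:~R) :
  u != d1 p -> z * z = conj y * y.
Proof.
(* With one unknown per class and one equation per class other than {1}, some nonzero class function
   (b1, b2) is multiplied by (z, y) into the multiples of 1. *)
move=> uN1; pose A := colors; pose B := colors :\ k1.
have cxy : cf z y by rewrite -[y]addr0; apply: cfD; [apply: cf_col | apply: cf_int].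
have zy : aug z = aug y by rewrite augD aug_int /defect addrC subrK.
have y_gt0 : 0 < aug y.
  have [j kuj] := color_mixed uN1.
  rewrite aug_ind ltz_nat card_gt0; apply/set0Pn; exists j.
  by rewrite inE kuj.
have cz : conj z = z by apply: (conj_cf cxy).
pose P0 x' y' := z * x' + conj y * y'; pose P1 x' y' := conj z * y' + y * x'.
pose M c c' := pv (P0 (colX c) (colY c)) (P1 (colX c) (colY c)) (rep c').
have ltBA : (#|B| < #|A|)%N by rewrite [#|A|](cardsD1 k1) mem_colors.
have [h [[c0 Ac0 hc0] hM]] := int_dep M ltBA.
pose b1 := \sum_(c in A) colX c *~ h c; pose b2 := \sum_(c in A) colY c *~ h c.
have cb : cf b1 b2.
  rewrite /b1 /b2 sum_colX sum_colY => v w kvw.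
  by rewrite /pv; case: v w kvw => [[] ?] [[] ?] /= kvw; rewrite !ffunE kvw.
have P0E : P0 b1 b2 = \sum_(c in A) P0 (colX c) (colY c) *~ h c.
  rewrite /P0 !mulr_sumr -big_split; apply: eq_bigr => c _ /=.
  by rewrite mulrzDl -!mulrzAr.
have P1E : P1 b1 b2 = \sum_(c in A) P1 (colX c) (colY c) *~ h c.
  rewrite /P1 !mulr_sumr -big_split; apply: eq_bigr => c _ /=.
  by rewrite mulrzDl -!mulrzAr.
have cP : cf (P0 b1 b2) (P1 b1 b2) by apply: (ScoloringM kS).
have Pv0 v : v != d1 p -> pv (P0 b1 b2) (P1 b1 b2) v = 0.
  move=> vN1; rewrite (cP v (rep (k v))) ?repK // -[RHS](hM (k v)); last first.
    by rewrite !inE mem_colors andbT; apply: contra vN1 => /eqP/(Scoloring1 kS)->.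
  rewrite P0E P1E /M /pv; case: ((rep _).1); rewrite cg_sum; apply: eq_bigr => c _;
  by rewrite cgMz mulrC.
have P10 : P1 b1 b2 = 0 by apply/ffunP=> j; rewrite cg0; apply: (Pv0 (true, j)).
have P00 : P0 b1 b2 = 0.
  have Pj j : j != 0 -> P0 b1 b2 j = 0.
    by move=> jN0; apply: (Pv0 (false, j)); apply: contra jN0 => /eqP[->].
  apply/ffunP=> j; rewrite cg0; have [->|] := eqVneq j 0; last exact: Pj.
  have <- : aug (P0 b1 b2) = P0 b1 b2 0.
    by rewrite /aug (bigD1 0) //= big1 ?addr0.
  (* The sign character vanishes on (z, y), hence on the product; this supplies the missing equation
     at 1. *)
  have : aug (P0 b1 b2) - aug (P1 b1 b2) = 0.
    by rewrite /P0 /P1 !augD !augM !aug_conj zy; ring.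
  have -> : aug (P1 b1 b2) = 0 by rewrite P10 /aug big1 // => l _; rewrite cg0.
  by rewrite subr0.
(* N is the determinant of multiplication by (z, y); the adjugate matrix shows that it kills b1 and
   b2. *)
pose N := z * z - conj y * y.
have Nb1 : N * b1 = 0.
  have -> : N * b1 = z * P0 b1 b2 - conj y * P1 b1 b2 by rewrite /P0 /P1 cz /N; ring.
  by rewrite P00 P10 !mulr0 subr0.
have Nb2 : N * b2 = 0.
  have -> : N * b2 = z * P1 b1 b2 - y * P0 b1 b2 by rewrite /P0 /P1 cz /N; ring.
  by rewrite P00 P10 !mulr0 subr0.
have N0 : (exists c : int, N = cgJ *~ c) -> z * z = conj y * y.
  case=> c Nc; apply: subr0_eq; rewrite -/N Nc.
  have : aug N = 0 by rewrite augB !augM aug_conj zy subrr.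
  rewrite Nc augMz augJ // => /eqP; rewrite mulf_eq0 => /orP[/eqP|/eqP->//].
  by have := prime_gt0 p_pr; lia.
case: (cg_mul_eq0 p_pr Nb1) => // -[c1 b1E].
case: (cg_mul_eq0 p_pr Nb2) => // -[c2 b2E].
(* If b1 and b2 are both multiples of J, the mixed class forces equal factors, and then the
   vanishing of the product with (z, y) forces them to be 0. *)
have c12 : c1 = c2.
  have := cb _ _ mix; rewrite /pv /= b1E b2E !cgMz !cgJE !mul1r.
  by [].
have c10 : c1 = 0.
  have := P00; rewrite /P0 b1E b2E -c12 !mulrzAr ![_ * cgJ]mulrC !cgJM.
  rewrite aug_conj zy -!mulrzA -mulrzDr => /mulJ_eq0; nia.
case/imsetP: Ac0 => v _ vE; case/eqP: hc0; rewrite vE.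
have : pv b1 b2 v = h (k v).
  by rewrite /b1 /b2 sum_colX sum_colY /pv; case: v {vE} => [[] j] /=; rewrite ffunE.
by rewrite b1E b2E -c12 c10 /pv; case: v {vE} => [[] j]; rewrite !mulr0z cg0.
Qed.

Lemma aug_ind_mul0 (S : {set 'F_p}) : (conj (ind S) * ind S) 0 = aug (ind S).
Proof.
by rewrite conjM0; apply: eq_bigr => i _; rewrite indE; case: (i \in S).
Qed.

(** The constant term of [norm_eq0] reads |X| + m^2 = |Y| with m = |Y| - |X|; the cross term
    vanishes because 1 is outside the class. *)
Lemma defect01 u : u != d1 p -> defect (k u) = 0 \/ defect (k u) = 1.
Proof.
move=> uN1; have := norm_eq0 uN1; set x := colX _; set y := colY _; set m := defect _.
have cx : conj x = x by apply: (conj_cf (@cf_col (k u))).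
have -> : (x + m%:~R) * (x + m%:~R) = conj x * x + (m + m)%:~R * x + (m * m)%:~R.
  by rewrite cx !intrM intrD; ring.
move/(congr1 (fun w : cgr p => w 0)); rewrite !cgD !aug_ind_mul0.
have x0 : x 0 = 0.
  rewrite colXE; case: eqP => // ku; case/eqP: uN1.
  by apply: (Scoloring1 kS); rewrite -ku.
have -> : ((m + m)%:~R * x) 0 = 0 by rewrite mulrC mulrzr cgMz x0 mul0r.
rewrite addr0 cgint eqxx mul1r => E.
have mE : m = aug y - aug x by [].
have /eqP : m * (m - 1) = 0 by have {}E : aug x + m * m = aug y := E; lia.
by rewrite mulf_eq0 (subr_eq0 m 1) => /orP[] /eqP ->; [left | right].
Qed.

(** There are as many rotations as reflections, so all defects sum to 0, and the class {1} has
    defect -1. *)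
Lemma sum_defect : \sum_(c in colors | c != k1) defect c = 1.
Proof.
have S : \sum_(c in colors) defect c = 0.
  rewrite sumrB; apply/eqP; rewrite subr_eq0; apply/eqP.
  transitivity (aug (cgJ : cgr p)); last symmetry.
    rewrite -aug_sum; congr aug; transitivity (\sum_(c in colors) colY c *~ 1) => //.
    by rewrite sum_colY; apply/ffunP=> i; rewrite !ffunE.
  rewrite -aug_sum; congr aug; transitivity (\sum_(c in colors) colX c *~ 1) => //.
  by rewrite sum_colX; apply/ffunP=> i; rewrite !ffunE.
move: S; rewrite (bigD1 k1) ?mem_colors //= /defect colX1 colY1 aug1.
have -> : aug (0 : cgr p) = 0 by rewrite /aug big1 // => i _; rewrite cg0.
by rewrite sub0r => /eqP; rewrite addrC subr_eq0 => /eqP.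
Qed.

Lemma special_color : exists2 g, g != d1 p & defect (k g) = 1 /\
  forall u, u != d1 p -> k u <> k g -> defect (k u) = 0.
Proof.
have nz u : k u != k1 -> u != d1 p by apply: contra => /eqP->.
have ge0 c : (c \in colors) && (c != k1) -> 0 <= defect c.
  by case/andP=> /imsetP[u _ ->] /nz /defect01[] ->.
have [g gN1 g1] : exists2 g, g != d1 p & defect (k g) = 1.
  have [/existsP[g /andP[gN1 /eqP]]|] :=
    boolP [exists g, (g != d1 p) && (defect (k g) == 1)]; first by exists g.
  rewrite negb_exists => /forallP no1; have := sum_defect; rewrite big1 // => c.
  case/andP=> /imsetP[u _ ->] /nz uN1; have := no1 u; rewrite uN1 /=.
  by case: (defect01 uN1) => ->.
have kgN1 : k g != k1 by apply: contra gN1 => /eqP/(Scoloring1 kS)->.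
exists g => //; split=> // u uN1 kug; have := sum_defect.
rewrite (bigD1 (k g)) /= ?mem_colors // g1 => /eqP.
rewrite -subr_eq0 [1 + _]addrC addrK => /eqP/psumr_eq0P E.
apply: E => [c /andP[/ge0]//|]; rewrite mem_colors /=; apply/andP; split; last exact/eqP.
by apply: contra uN1 => /eqP/(Scoloring1 kS)->.
Qed.

End Mixed.

End Coloring.

Section Correlation.

Variable p : nat.
Implicit Types S : {set 'F_p}.

Lemma corr_le S S' i : (conj (ind S) * ind S') i <= aug (ind S).
Proof.
rewrite cgM_conj; apply: ler_sum => j _; rewrite !indE.
by case: (j \in S); case: (_ \in S').
Qed.

(** The coefficient at [i] counts the elements of S that translation by [i] takes into S'. *)
Lemma corr_full S S' i : (conj (ind S) * ind S') i = aug (ind S) ->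
  forall j, j \in S -> i + j \in S'.
Proof.
rewrite cgM_conj => E j Sj; apply/negPn/negP => S'ij.
have: \sum_j (ind S j - ind S j * ind S' (i + j)) = 0 by rewrite sumrB E subrr.
move/psumr_eq0P => /= F; have: ind S j - ind S j * ind S' (i + j) = 0.
  by apply: F => // l _; rewrite !indE; case: (l \in S); case: (_ \in S').
by rewrite !indE Sj (negPf S'ij).
Qed.

End Correlation.

Section MixedColoring.

Variables (p : nat) (p_pr : prime p) (T : finType) (k : dih p -> T).
Hypothesis kS : Scoloring k.
Variables (i0 j0 : 'F_p) (mix : k (false, i0) = k (true, j0)).
Implicit Types (x y : cgr p) (i j t d : 'F_p) (u v g : dih p).

Notation cf := (pair_class_fun k).
Notation k1 := (k (d1 p)).
Notation X := (colX k).
Notation Y := (colY k).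

(** In the expansion by class sums only {1} and the class of g contribute to the difference, with
    defects -1 and 1. *)
Lemma aug_diff_special g x y : g != d1 p -> defect k (k g) = 1 ->
    (forall u, u != d1 p -> k u <> k g -> defect k (k u) = 0) ->
  cf x y -> aug x - aug y = pv x y (d1 p) - pv x y g.
Proof.
move=> gN1 g1 dg0 cxy; have [xE yE] := cf_expand cxy.
have kgN1 : k g != k1 by apply: contra gN1 => /eqP/(Scoloring1 kS)->.
move: (congr1 (@aug p) xE) (congr1 (@aug p) yE); rewrite !aug_sum => -> ->.
rewrite -sumrB.
rewrite (bigD1 k1) ?mem_colors //= (bigD1 (k g)) ?mem_colors //=.
rewrite big1 ?addr0 => [|c /andP[/andP[/imsetP[u _ ->] uN1] ug]].
  rewrite !augMz -!mulrBl -[aug (X (k g)) - _]opprB -[_ - aug (X (k g))]/(defect k (k g)).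
  rewrite g1 (colX1 kS) (colY1 kS) aug1 mulN1r.
  have -> : aug (0 : cgr p) = 0 by rewrite /aug big1 // => i _; rewrite cg0.
  by rewrite subr0 mul1r !(cxy _ _ (repK k _)).
rewrite !augMz -mulrBl -opprB -/(defect k (k u)) dg0 ?oppr0 ?mul0r //.
  by apply: contra uN1 => /eqP->.
by move/eqP: ug.
Qed.

(* A class [T] of defect 0 has a square of defect 0, so the class of defect 1 *)
(* occurs in [T * T] with the coefficient [|T|] of the identity: its elements *)
(* stabilize [T], and this forces it to be a single reflection.               *)
Lemma mixed_structure :
  (forall u v, u != d1 p -> v != d1 p -> k u = k v) \/
  exists d, (forall u, k u = k (true, d) -> u = (true, d)) /\
            (forall i, i != 0 -> k (true, d + i) = k (false, i)).
Proof.
have [g gN1 [g1 dg0]] := special_color p_pr kS mix.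
have [/existsP[u /andP[uN1 ug]]|] := boolP [exists u, (u != d1 p) && (k u != k g)]; last first.
  rewrite negb_exists => /forallP allg; left => u v uN1 vN1.
  by move: (allg u) (allg v); rewrite uN1 vN1 /= !negbK => /eqP-> /eqP->.
right.
have key v h : v != d1 p -> k v != k g -> k h = k g ->
    pv (conj (X (k v)) * X (k v) + conj (Y (k v)) * Y (k v))
       (conj (X (k v)) * Y (k v) + conj (X (k v)) * Y (k v)) h
      = aug (X (k v)) + aug (Y (k v)) /\ aug (X (k v)) = aug (Y (k v)).
  move=> vN1 /eqP vg hg; have := ScoloringM kS (@cf_col p T k (k v)) (@cf_col p T k (k v)).
  have cX : conj (X (k v)) = X (k v) by apply: (conj_cf p_pr kS mix (@cf_col p T k (k v))).
  rewrite [Y _ * X _]mulrC -{1 4}cX => cP.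
  have /subr0_eq E : aug (Y (k v)) - aug (X (k v)) = 0 by apply: dg0.
  split=> //; move: (aug_diff_special gN1 g1 dg0 cP).
  rewrite !augD !augM !aug_conj E subrr (cP _ _ hg) => /eqP; rewrite eq_sym subr_eq0 => /eqP<-.
  by rewrite /pv /= cgD !aug_ind_mul0 -E.
(* A rotation in the class of g would stabilize the reflections in the class of u. As it generates
   all rotations, that class would contain every reflection and, having defect 0, every rotation,
   including 1. *)
have gS i : k (false, i) <> k g.
  move=> ig; have [E XY] := key u _ uN1 ug ig.
  have iN0 : i != 0.
    apply: contra gN1 => /eqP i0'; apply/eqP/(Scoloring1 kS).
    by rewrite -ig i0'.
  have {E} : (conj (Y (k u)) * Y (k u)) i = aug (Y (k u)).
    move: E; rewrite /pv /= cgD.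
    move: (corr_le [set j | k (false, j) == k u] [set j | k (false, j) == k u] i).
    move: (corr_le [set j | k (true, j) == k u] [set j | k (true, j) == k u] i).
    by rewrite -/(X (k u)) -/(Y (k u)); lia.
  move/corr_full => shift; have [j uj] := color_mixed p_pr kS mix uN1.
  have Yn n : k (true, i *+ n + j) = k u.
    elim: n => [|n IHn]; first by rewrite add0r.
    have := shift (i *+ n + j); rewrite !inE IHn eqxx => /(_ isT) /eqP <-.
    by rewrite mulrS addrA.
  have YT : aug (Y (k u)) = p%:Z.
    rewrite -(augJ p_pr); congr aug; apply/ffunP=> l; rewrite cgJE colYE.
    pose n : 'F_p := i^-1 * (l - j); have <- : i *+ n + j = l.
      by rewrite -mulr_natr natr_Zp mulVKf // subrK.
    by rewrite Yn eqxx.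
  have XT : [set l | k (false, l) == k u] = [set: 'F_p].
    apply/eqP; rewrite eqEcard subsetT /= cardsT card_Fp //.
    by move: XY; rewrite YT aug_ind => -[->].
  case/eqP: uN1; apply: (Scoloring1 kS); apply/esym/eqP.
  by move/setP/(_ 0): XT; rewrite !inE.
have X0 : aug (X (k g)) = 0.
  by rewrite /aug big1 // => i _; rewrite colXE; case: eqP => // /gS.
have /eqP/cards1P[d gd] : #|[set j | k (true, j) == k g]| = 1%N.
  by move: g1; rewrite /defect X0 aug_ind subr0 => -[].
have kd : k (true, d) = k g.
  by apply/eqP; move/setP/(_ d): gd; rewrite !inE eqxx.
exists d; split=> [[[] j]|i iN0]; rewrite ?kd.
  by move/eqP; move/setP/(_ j): gd; rewrite !inE => -> /eqP->.
  by move/gS.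
have iN1 : (false, i) != d1 p by apply: contra iN0 => /eqP[->].
have ig : k (false, i) != k g by apply/eqP/gS.
have [E XY] := key _ _ iN1 ig kd.
have {}E : (conj (X (k (false, i))) * Y (k (false, i))) d = aug (X (k (false, i))).
  by move: E; rewrite /pv /= cgD XY; lia.
by have := corr_full E; move/(_ i); rewrite !inE eqxx => /(_ isT)/eqP.
Qed.

(** In the nontrivial case let s' be the reflection [(true, d)]: [r] labels the right cosets of {1,
    s'}, and outside {1, s'} the colour depends only on the label. Scaling labels by a multiplier
    and permuting inside cosets then give automorphisms. *)
Lemma mixed_color_schurian : color_schurian k.
Proof.
case: mixed_structure => [|[d [kd kT]]].
  exact: trivial_color_schurian (Scoloring1 kS).
pose c i := k (false, i).
pose r u : 'F_p := if u.1 then u.2 - d else u.2.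
have cN i : c (- i) = c i by exact: (rotation_sym p_pr kS mix i).
have kr u : r u != 0 -> k u = c (r u).
  by case: u => [[] i] //; rewrite /r /c /= => iN0; rewrite -kT // addrC subrK.
have r0 u : r u = 0 -> u = d1 p \/ u = (true, d).
  case: u => [[] i]; rewrite /r /=; last by move->; left.
  by move/subr0_eq->; right.
have c0 i : c i = c 0 -> i = 0 by move/(Scoloring1 kS) => [].
have rk u v : k u = k v -> c (r u) = c (r v).
  have [/r0[]-> kuv|ruN0] := eqVneq (r u) 0.
  - by rewrite (Scoloring1 kS (esym kuv)).
  - by rewrite (kd _ (esym kuv)).
  have [/r0[]-> kuv|rvN0] := eqVneq (r v) 0; last by rewrite -!kr.
  - by rewrite (Scoloring1 kS kuv).
  - by rewrite (kd _ kuv).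
have cM x y : class_fun c x -> class_fun c y -> class_fun c (x * y).
  have lift z : class_fun c z -> cf z (cgd d * z).
    move=> cz u v /rk/cz; rewrite /r /pv.
    by case: u => [[] i]; case: v => [[] j] /=; rewrite ?cgdM.
  move=> cx cy i j cij; have := ScoloringM kS (lift _ cx) (lift _ cy) cij.
  have -> : conj (cgd d * x) * (cgd d * y) = x * y.
    rewrite conjM (conj_cf p_pr kS mix (lift _ cx)) /conj actd ?oppr1_neq0 // mulN1r.
    by rewrite mulrCA !mulrA -cgdD subrr mul1r.
  by rewrite /pv /= !cgD; lia.
have cZ t i j : c i = c j -> c (t * i) = c (t * j) by apply: (multiplier p_pr cM).
have pres (f : {perm dih p}) t : c t = c 1 ->
    (forall u, r (f u) = t * r u) -> forall a b, k (ddiv (f a) (f b)) = k (ddiv a b).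
  move=> ct rf a b; have [->|aNb] := eqVneq a b; first by rewrite !ddivvv.
  have tN0 : t != 0.
    apply: contra_eq_neq ct => ->; apply: contra_neq (oner_neq0 'F_p).
    by move/esym/c0.
  have divr a' b' : r (ddiv a' b') = r a' - r b' \/ r (ddiv a' b') = r b' - r a'.
    case: a' b' => [[] i] [[] j]; rewrite ddivE /r /=;
    by [left; ring | right; ring].
  have div0 a' b' : a' != b' -> r a' = r b' -> ddiv a' b' = (true, d).
    move=> abN rab; have rd : r (ddiv a' b') = 0 by case: (divr a' b') => ->; rewrite rab subrr.
    by case: (r0 _ rd) => // /ddiv_eq1/eqP; rewrite (negPf abN).
  have [rab|rabN] := eqVneq (r a) (r b).
    have fab : f a != f b by rewrite (inj_eq perm_inj).
    by rewrite (div0 _ _ fab) ?(div0 _ _ aNb) // !rf rab.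
  have kdiv a' b' : r a' != r b' -> k (ddiv a' b') = c (r a' - r b').
    move=> rN; case: (divr a' b') => E; rewrite kr E ?subr_eq0 //.
      by rewrite -cN opprB.
    by rewrite eq_sym.
  rewrite !kdiv //; last by rewrite !rf (inj_eq (mulfI tN0)).
  by rewrite !rf -mulrBr; have := cZ (r a - r b) _ _ ct; rewrite mulr1 mulrC.
move=> u v kuv; have [ru|ruN0] := eqVneq (r u) 0.
  have -> : v = u.
    case: (r0 _ ru) => uE; rewrite uE in kuv *.
    by rewrite (Scoloring1 kS (esym kuv)).
    by rewrite (kd _ (esym kuv)).
  by exists 1%g; split; rewrite ?perm1 // => a b; rewrite !perm1.
have crr := rk _ _ kuv.
have rvN0 : r v != 0 by apply: contra ruN0 => /eqP rv; rewrite rv in crr; rewrite (c0 _ crr).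
pose t := r v / r u.
have ct : c t = c 1.
  by have := cZ (r u)^-1 _ _ (esym crr); rewrite mulVf // mulrC.
have tN0 : t != 0 by rewrite mulf_neq0 // invr_eq0.
pose f w : dih p := if w.1 then (true, t * (w.2 - d) + d) else (false, t * w.2).
have f_inj : injective f.
  move=> a b E; move: (congr1 fst E) (congr1 snd E).
  by rewrite /f; case: a b {E} => [[] a] [[] b] //= _ => [/addIr/(mulfI tN0)/addIr->|/(mulfI tN0)->].
have rf w : r (f w) = t * r w by case: w => [[] i]; rewrite /r /f //= addrK.
(* Scaling by t takes u into the coset of v; the transposition corrects the point within this
   coset. *)
exists (perm f_inj * tperm (f u) v)%g; have rfu : r (f u) = r v by rewrite rf mulfVK.
have rt w : r (tperm (f u) v w) = r w by case: tpermP => // ->.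
have f1 : f (d1 p) = d1 p by rewrite /f /= mulr0.
split.
- rewrite permM (permE f_inj) f1 tpermD //; last by apply: contra rvN0 => /eqP->.
  by apply: contra rvN0 => /eqP fu1; rewrite -rfu fu1.
- by rewrite permM (permE f_inj) tpermL.
by apply: (pres _ t) => // w; rewrite permM (permE f_inj) rt rf.
Qed.

End MixedColoring.

(* Multiplication by [w] is injective on class functions by [cg_mul_eq0].     *)
Lemma card_colors_le p (p_pr : prime p) (T : finType) (c s : 'F_p -> T) (w : cgr p) :
    (forall n : int, w <> cgJ *~ n) -> aug w != 0 ->
    (forall x, class_fun c x -> class_fun s (w * x)) ->
  (#|c @: [set: 'F_p]| <= #|s @: [set: 'F_p]|)%N.
Proof.
move=> wN wN0 csw; rewrite leqNgt; apply/negP=> lt_sc.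
pose C a : cgr p := ind [set i | c i == a].
pose sr a : 'F_p := odflt 0 [pick i | s i == a].
have srK i : s (sr (s i)) = s i.
  by rewrite /sr; case: pickP => [j /eqP //|/(_ i)]; rewrite eqxx.
have [h [[_ /imsetP[i _ ->] hN0] hM]] := int_dep (fun a b => (w * C a) (sr b)) lt_sc.
pose x : cgr p := [ffun i => h (c i)].
have cx : class_fun c x by move=> j l cjl; rewrite !ffunE cjl.
have xE : x = \sum_(a in c @: [set: 'F_p]) C a *~ h a.
  apply/ffunP=> j; rewrite cg_sum ffunE (bigD1 (c j)) ?imset_f ?inE //=.
  rewrite cgMz indE inE eqxx mul1r big1 ?addr0 // => a /andP[_].
  by rewrite cgMz indE inE eq_sym => /negPf->; rewrite mul0r.
have wx0 : w * x = 0.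
  apply/ffunP=> j; rewrite cg0 (csw _ cx j (sr (s j))) ?srK // -[RHS](hM (s j)) ?imset_f ?inE //.
  rewrite xE mulr_sumr cg_sum; apply: eq_bigr => a _.
  by rewrite mulrzAr cgMz mulrC.
case: (cg_mul_eq0 p_pr wx0) => [[n /wN//]|[n xn]].
have n0 : n = 0.
  have := wx0; rewrite xn mulrzAr mulrC cgJM -mulrzA => /mulJ_eq0/eqP.
  by rewrite mulf_eq0 (negPf wN0) => /eqP.
by case/eqP: hN0; move/ffunP/(_ i): xn; rewrite n0 mulr0z cg0 ffunE.
Qed.

(** * Colourings that separate rotations from reflections *)

Section PureColoring.

Variables (p : nat) (p_pr : prime p) (T : finType) (k : dih p -> T).
Hypothesis kS : Scoloring k.
Hypothesis pure : forall i j, k (false, i) <> k (true, j).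
Implicit Types (x y : cgr p) (i j t d : 'F_p) (u v g : dih p).

Notation c := (fun i => k (false, i)).
Notation s := (fun i => k (true, i)).
Notation cf := (pair_class_fun k).

Lemma pure_cf x y : class_fun c x -> class_fun s y -> cf x y.
Proof.
move=> cx sy [[] i] [[] j]; rewrite /pv /=; [exact: sy | | | exact: cx].
  by move/esym/pure.
by move/pure.
Qed.

Lemma class_fun0 (g : 'F_p -> T) : class_fun g 0.
Proof. by move=> i j _; rewrite !cg0. Qed.

Lemma pure_ccM x x' : class_fun c x -> class_fun c x' -> class_fun c (x * x').
Proof.
move=> cx cx' i j kij; have c0 := @class_fun0 s.
have := ScoloringM kS (pure_cf cx c0) (pure_cf cx' c0) kij.
by rewrite /pv /= mulr0 addr0.
Qed.

Lemma pure_conj x : class_fun c x -> class_fun c (conj x).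
Proof. by move=> cx i j kij; apply: (ScoloringV kS (pure_cf cx (@class_fun0 s)) kij). Qed.

Lemma pure_csM x y : class_fun c x -> class_fun s y -> class_fun s (x * y).
Proof.
move=> /pure_conj cx sy i j kij.
have := ScoloringM kS (pure_cf cx (@class_fun0 s)) (pure_cf (@class_fun0 c) sy) kij.
by rewrite /pv /= conjK mulr0 addr0.
Qed.

Lemma pure_ssM y y' : class_fun s y -> class_fun s y' -> class_fun c (conj y * y').
Proof.
move=> sy sy' i j kij.
have := ScoloringM kS (pure_cf (@class_fun0 c) sy) (pure_cf (@class_fun0 c) sy') kij.
by rewrite /pv /= mul0r add0r.
Qed.

Lemma pure_multiplier t i j : c i = c j -> c (t * i) = c (t * j).
Proof. exact: (multiplier p_pr pure_ccM). Qed.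

Lemma pure_c0 i : c i = c 0 -> i = 0.
Proof. by move/(Scoloring1 kS) => []. Qed.

Lemma pure_ratio i j : c i = c j -> i != 0 ->
  j / i != 0 /\ forall l, c (j / i * l) = c l.
Proof.
move=> cij iN0; have jN0 : j != 0.
  by apply: contra iN0 => /eqP j0; rewrite j0 in cij; rewrite (pure_c0 cij).
split=> [|l]; first by rewrite mulf_neq0 // invr_eq0.
have := pure_multiplier i^-1 (esym cij); rewrite mulVf // => /(pure_multiplier l).
by rewrite mulr1 (mulrC l) (mulrC i^-1).
Qed.

(** The quotient of a rotation and a reflection is a reflection, and these share one colour. So
    translating the reflections alone, or scaling the rotations alone by a multiplier, is an
    automorphism. *)
Lemma pure_constant_schurian : (forall i j, s i = s j) -> color_schurian k.
Proof.
move=> s_const [[] i] [[] j] kij; [ | by case: (pure (esym kij)) | by case: (pure kij) | ].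
  pose f (w : dih p) : dih p := if w.1 then (true, w.2 + (j - i)) else w.
  have f_inj : injective f.
    move=> a b E; move: (congr1 fst E) (congr1 snd E).
    by rewrite /f; case: a b {E} => [[] a] [[] b] //= _ => [/addIr->|->].
  exists (perm f_inj); split; rewrite ?permE //=; first by rewrite /f /= addrC subrK.
  move=> [[] a] [[] b]; rewrite !permE /f !ddivE //=; try exact: s_const.
  by congr (k (false, _)); ring.
have [i0|iN0] := eqVneq i 0.
  move: kij; rewrite i0 => /esym/pure_c0->.
  by exists 1%g; split; rewrite ?perm1 // => a b; rewrite !perm1.
have [tN0 ct] := pure_ratio kij iN0; set t := j / i in tN0 ct.
pose f (w : dih p) : dih p := if w.1 then w else (false, t * w.2).
have f_inj : injective f.
  move=> a b E; move: (congr1 fst E) (congr1 snd E).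
  by rewrite /f; case: a b {E} => [[] a] [[] b] //= _ => [->|/(mulfI tN0)->].
exists (perm f_inj); split; rewrite ?permE //=.
- by rewrite /f /= mulr0.
- by rewrite /f /= mulfVK.
by move=> [[] a] [[] b]; rewrite !permE /f !ddivE //= -?mulrBr //; apply: s_const.
Qed.

(** Multiplication by the isolated reflection s r^d exchanges rotation classes and reflection
    classes. Hence the group automorphism r^i -> r^(t i) fixing s r^d preserves all colours once it
    preserves those of rotations. *)
Lemma pure_point_schurian d : (forall j, s j = s d -> j = d) -> color_schurian k.
Proof.
move=> sd; have cd : class_fun s (cgd d).
  move=> i j kij; rewrite !ffunE; congr (nat_of_bool _)%:R.
  by apply/idP/idP => /eqP E; rewrite E in kij; rewrite (sd _ kij) || rewrite (sd _ (esym kij)).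
have s_c i j : s i = s j -> c (i - d) = c (j - d).
  move=> kij; pose x : cgr p := ind [set l | c l == c (i - d)].
  have cx : class_fun c x by move=> a b cab; rewrite !indE !inE cab.
  have := pure_csM cx cd kij; rewrite mulrC !cgdM !indE !inE eqxx.
  by case: eqP.
have c_s i j : c i = c j -> s (d + i) = s (d + j).
  move=> kij; pose y : cgr p := ind [set l | s l == s (d + i)].
  have sy : class_fun s y by move=> a b cab; rewrite !indE !inE cab.
  have := pure_ssM cd sy kij; rewrite /conj actd ?oppr1_neq0 // mulN1r !cgdM.
  by rewrite !opprK ![_ + d]addrC !indE !inE eqxx; case: eqP.
suff main t u v : t != 0 -> (forall l, c (t * l) = c l) ->
    (if u.1 then (true, t * (u.2 - d) + d) else (false, t * u.2)) = v ->
    exists f : {perm dih p}, [/\ f (d1 p) = d1 p, f u = v &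
       forall a b, k (ddiv (f a) (f b)) = k (ddiv a b)].
  have id_ok u : exists f : {perm dih p}, [/\ f (d1 p) = d1 p, f u = u &
       forall a b, k (ddiv (f a) (f b)) = k (ddiv a b)].
    by exists 1%g; split; rewrite ?perm1 // => a b; rewrite !perm1.
  move=> [[] i] [[] j] kij; [ | by case: (pure (esym kij)) | by case: (pure kij) | ].
    have [iE|iNd] := eqVneq i d; first by rewrite iE in kij *; rewrite (sd j).
    have iN0 : i - d != 0 by rewrite subr_eq0.
    have [tN0 ct] := pure_ratio (s_c _ _ kij) iN0.
    by apply: main tN0 ct _; rewrite /= mulfVK // subrK.
  have [i0|iN0] := eqVneq i 0.
    by move: kij; rewrite i0 => /esym/pure_c0->.
  have [tN0 ct] := pure_ratio kij iN0.
  by apply: main tN0 ct _; rewrite /= mulfVK.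
move=> tN0 ct uv.
pose f (w : dih p) : dih p := if w.1 then (true, t * (w.2 - d) + d) else (false, t * w.2).
have f_inj : injective f.
  move=> a b E; move: (congr1 fst E) (congr1 snd E).
  by rewrite /f; case: a b {E} => [[] a] [[] b] //= _ => [/addIr/(mulfI tN0)/addIr->|/(mulfI tN0)->].
have kf w : k (f w) = k w.
  case: w => [[] i]; rewrite /f /=; last exact: ct.
  by rewrite addrC (c_s _ (i - d)) ?ct // addrC subrK.
exists (perm f_inj); split; rewrite ?permE //; first by rewrite /f /= mulr0.
move=> a b; rewrite !permE -[RHS]kf; congr k.
by case: a b => [[] i] [[] j]; rewrite /f !ddivE /=; congr (_, _); ring.
Qed.

(** The order of the subgroup M of multipliers that fix every class of rotations: M is the class of
    r. *)
Definition cvalency := #|[set t : 'F_p | k (false, t) == k (false, 1)]|.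
Definition ssize a := #|[set j : 'F_p | k (true, j) == a]|.
Definition scolors := s @: [set: 'F_p].

Lemma card_cclass i : i != 0 -> #|[set j | c j == c i]| = cvalency.
Proof.
move=> iN0; rewrite -[RHS](card_imset _ (mulIf iN0)); apply: eq_card => j.
rewrite inE; apply/idP/imsetP => [/eqP cji|[t]].
  exists (j / i); last by rewrite mulfVK.
  rewrite inE; apply/eqP; have := pure_multiplier i^-1 cji.
  by rewrite mulVf // mulrC.
by rewrite inE => /eqP ct ->; have := pure_multiplier i ct; rewrite mulr1 mulrC => ->.
Qed.

Lemma cclass0 : [set j | c j == c 0] = [set 0].
Proof. by apply/setP=> j; rewrite !inE; apply/idP/idP => /eqP => [/pure_c0->|->]. Qed.

(** Every class of nontrivial rotations is a coset of M, hence has [cvalency] elements. *)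
Lemma dvd_aug x : class_fun c x -> (cvalency %| aug x - x 0%R)%Z.
Proof.
move=> cx; rewrite /aug (partition_big_imset c) /= (bigD1 (c 0)) ?imset_f //=.
have -> : \sum_(i | c i == c 0) x i = x 0.
  by rewrite (eq_bigl (pred1 0)) ?big_pred1_eq // => i; have := in_set (fun j => c j == c 0) i; rewrite cclass0 inE.
rewrite addrC addrK; apply: rpred_sum => a /andP[/imsetP[i _ ->] cN].
have iN0 : i != 0 by apply: contra cN => /eqP->.
rewrite (eq_bigr (fun=> x i)) => [|j /eqP cji]; last exact: cx.
rewrite sumr_const; have := card_cclass iN0; rewrite cardsE => ->.
by rewrite -mulr_natl natz dvdz_mulr.
Qed.

Lemma card_ccolors : (#|c @: [set: 'F_p]|.-1 * cvalency).+1 = p.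
Proof.
rewrite -[RHS](card_Fp p_pr) -cardsT -[RHS]sum1_card (partition_big_imset c) /=.
have inner a : (\sum_(i in [set: 'F_p] | c i == a) 1)%N = #|[set j | c j == a]|.
  by rewrite -sum1_card; apply: eq_bigl => i; rewrite !inE.
have c0 : c 0 \in c @: [set: 'F_p] by apply: imset_f.
rewrite (bigD1 (c 0)) //= inner cclass0 cards1 add1n; congr _.+1.
have -> : #|c @: [set: 'F_p]|.-1 = #|(c @: [set: 'F_p]) :\ c 0|.
  by rewrite (cardsD1 (c 0) (_ @: _)) c0.
rewrite -sum_nat_const; symmetry; apply: eq_big => [a|a /andP[/imsetP[i _ ->] aN]].
  by rewrite !inE andbC.
rewrite inner card_cclass //; apply: contra aN => /eqP->; exact: eqxx.
Qed.

Section Sizes.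

Hypothesis s_nonconst : exists i j, s i <> s j.

Lemma scol_nonconst i (n : int) : ind [set j | s j == s i] <> cgJ *~ n.
Proof.
move=> E; have [l sli] : exists l, s l != s i.
  have [a [b ab]] := s_nonconst; have [sa|] := eqVneq (s a) (s i); last by exists a.
  by exists b; rewrite -sa; apply/eqP => sb; apply: ab.
have := congr1 (fun x : cgr p => x i - x l) E.
by rewrite !cgMz !cgJE subrr !indE !inE eqxx (negPf sli).
Qed.

(** For y a class of reflections, not a multiple of J, multiplication by y and by conj y carries
    class functions on rotations to those on reflections and back, injectively both ways. *)
Lemma card_scolors : #|scolors| = #|c @: [set: 'F_p]|.
Proof.
pose y : cgr p := ind [set j | s j == s 0].
have sy : class_fun s y by move=> i j sij; rewrite !indE !inE sij.
have yN0 : aug y != 0.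
  rewrite aug_ind eqz_nat cards_eq0; apply/set0Pn; exists 0.
  by rewrite inE.
apply/eqP; rewrite eqn_leq; apply/andP; split.
  apply: (card_colors_le p_pr (w := conj y)) => [n|//|x].
  - move/(congr1 (@conj p)); rewrite conjK /conj actMz actJ; exact: scol_nonconst.
  - by rewrite aug_conj.
  exact: pure_ssM.
apply: (card_colors_le p_pr (w := y)) => [n|//|x cx]; first exact: scol_nonconst.
by rewrite mulrC; apply: pure_csM.
Qed.

(** For distinct classes a and b of reflections, conj (y a) * y b has no constant term, so [dvd_aug]
    makes its augmentation, the product of the sizes, a multiple of [cvalency]. *)
Lemma pure_sizes : exists r, [/\ (r * cvalency).+1 = p, #|scolors| = r.+1,
  (\sum_(a in scolors) ssize a = p)%N,
  forall a, a \in scolors -> (0 < ssize a)%N &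
  forall a b, a \in scolors -> b \in scolors -> a != b ->
    (cvalency %| ssize a * ssize b)%N].
Proof.
exists #|c @: [set: 'F_p]|.-1; split.
- exact: card_ccolors.
- rewrite card_scolors prednK // card_gt0; apply/set0Pn; exists (c 0).
  exact: imset_f.
- rewrite -[RHS](card_Fp p_pr) -cardsT -[RHS]sum1_card (partition_big_imset s) /=.
  by apply: eq_bigr => a _; rewrite /ssize -sum1_card; apply: eq_bigl => i; rewrite !inE.
- move=> _ /imsetP[i _ ->]; rewrite card_gt0; apply/set0Pn; exists i.
  by rewrite inE.
move=> a b _ _ ab; pose y a : cgr p := ind [set j | s j == a].
have sy e : class_fun s (y e) by move=> i j sij; rewrite !indE !inE sij.
have := dvd_aug (pure_ssM (sy a) (sy b)); rewrite conjM0 big1 => [|i _].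
  by rewrite subr0 augM aug_conj !aug_ind.
by rewrite !indE !inE; case: eqP => [->|]; rewrite ?mul0r // (negPf ab) mulr0.
Qed.

End Sizes.

Lemma size1_schurian a : a \in scolors -> ssize a = 1%N -> color_schurian k.
Proof.
case/imsetP=> d _ -> /eqP/cards1P[e E].
apply: (pure_point_schurian (d := d)) => j sj.
have F := fun i => congr1 (fun A : {set 'F_p} => i \in A) E; move: (F j) (F d); rewrite !inE sj eqxx.
by move/esym/eqP=> -> /esym/eqP.
Qed.

End PureColoring.

(** * Class sizes and quadratic residues *)

(** If m is coprime to [K a0], it divides the r other sizes; these sum to at least r m, which leaves
    1 for [a0]. *)
Lemma coprime_size1 (T : finType) (B : {set T}) (K : T -> nat) m r a0 :
    #|B| = r.+1 -> (\sum_(a in B) K a)%N = (r * m).+1 ->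
    (forall a, a \in B -> 0 < K a)%N ->
    (forall a b, a \in B -> b \in B -> a != b -> m %| K a * K b)%N ->
  a0 \in B -> coprime m (K a0) -> K a0 = 1%N.
Proof.
move=> cardB sumB K_gt0 mK Ba0 co; have := K_gt0 _ Ba0.
have: (r * m <= \sum_(a in B | a != a0) K a)%N.
  have -> : r = #|B :\ a0| by move: cardB; rewrite (cardsD1 a0) Ba0 => -[].
  rewrite -sum_nat_const; under [X in (_ <= X)%N]eq_bigl => a.
    have -> : (a \in B) && (a != a0) = (a \in B :\ a0) by rewrite !inE andbC.
    over.
  apply: leq_sum => a; rewrite !inE => /andP[aa0 Ba]; apply: dvdn_leq; first exact: K_gt0.
  by have := mK _ _ Ba0 Ba; rewrite eq_sym aa0 Gauss_dvdr // => /(_ isT).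
by move: sumB; rewrite (bigD1 a0) //=; lia.
Qed.

(** Unless some size is coprime to l^e, the prime l divides every size, whereas the total is 1 mod
    l. *)
Lemma prime_power_size1 (T : finType) (B : {set T}) (K : T -> nat) l e r :
    prime l -> #|B| = r.+1 -> (\sum_(a in B) K a)%N = (r * l ^ e).+1 ->
    (forall a, a \in B -> 0 < K a)%N ->
    (forall a b, a \in B -> b \in B -> a != b -> l ^ e %| K a * K b)%N ->
  exists2 a, a \in B & K a = 1%N.
Proof.
move=> l_pr cardB sumB K_gt0 mK.
have [/existsP[a /andP[Ba co]]|] := boolP [exists a, (a \in B) && coprime (l ^ e) (K a)].
  by exists a => //; apply: (coprime_size1 cardB sumB K_gt0 mK).
rewrite negb_exists => /forallP noco.
have [e0|e_gt0] := posnP e.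
  have [a Ba] : exists a, a \in B by apply/set0Pn; rewrite -card_gt0 cardB.
  by have := noco a; rewrite Ba e0 coprime1n.
have: (l %| \sum_(a in B) K a)%N.
  apply: dvdn_sum => a Ba; have := noco a.
  by rewrite Ba /= coprime_pexpl // prime_coprime // negbK.
rewrite sumB -addn1 dvdn_addr ?dvdn1; first by move: l_pr => + /eqP l1; rewrite l1.
by apply: dvdn_mull; rewrite dvdn_exp.
Qed.

(** The total 4q + 1 is odd and 1 mod q, so some size is odd and some size is prime to q; these are
    different classes, as no size is coprime to 2q. Divisibility makes the first size a multiple of
    q and the third a multiple of 2q, and the total decides the rest. *)
Lemma sizes_2q (T : finType) (B : {set T}) (K : T -> nat) q :
    prime q -> odd q -> #|B| = 3 -> (\sum_(a in B) K a)%N = (2 * (2 * q)).+1 ->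
    (forall a, a \in B -> 0 < K a)%N ->
    (forall a b, a \in B -> b \in B -> a != b -> 2 * q %| K a * K b)%N ->
    (forall a, a \in B -> ~~ coprime (2 * q) (K a)) ->
  exists a b c, [/\ B = [set a; b; c], uniq [:: a; b; c] &
                    [/\ K a = q, K b = q.+1 & K c = (2 * q)%N]].
Proof.
move=> q_pr q_odd cardB sumB K_gt0 mK noco.
have [/existsP[a /andP[Ba Ka]]|] := boolP [exists a, (a \in B) && odd (K a)]; last first.
  rewrite negb_exists => /forallP allE.
  have: (2 %| \sum_(a in B) K a)%N.
    by apply: dvdn_sum => a Ba; have := allE a; rewrite Ba /= dvdn2.
  by rewrite sumB; lia.
have [/existsP[b /andP[Bb Kb]]|] := boolP [exists b, (b \in B) && ~~ (q %| K b)%N]; last first.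
  rewrite negb_exists => /forallP allE.
  have: (q %| \sum_(a in B) K a)%N.
    by apply: dvdn_sum => a' Ba'; have := allE a'; rewrite Ba' /= negbK.
  rewrite sumB -addn1 dvdn_addr ?dvdn1; first by move: q_pr => + /eqP q1; rewrite q1.
  by rewrite mulnA dvdn_mull.
have co2a : coprime 2 (K a) by rewrite prime_coprime // dvdn2 Ka.
have coqb : coprime q (K b) by rewrite prime_coprime.
have ab : a != b.
  apply: contraTneq coqb => <-; have := noco _ Ba.
  by rewrite coprimeMl co2a.
have [c Bc] : exists c, c \in B :\ a :\ b.
  apply/set0Pn; rewrite -card_gt0; move: cardB.
  by rewrite (cardsD1 a) Ba (cardsD1 b (B :\ a)) !inE eq_sym ab Bb /=; lia.
move: Bc; rewrite !inE => /and3P[cb ca Bc].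
have BE : B = [set a; b; c].
  apply/esym/eqP; rewrite eqEcard cardB; apply/andP; split.
    by apply/subsetP=> d; rewrite !inE => /orP[/orP[]|] /eqP->.
  by rewrite -setUA !cardsU1 cards1 !inE (negPf ab) ![_ == c]eq_sym (negPf ca) (negPf cb).
exists a, b, c; split=> //; first by rewrite /= !inE negb_or ab ![_ == c]eq_sym ca cb.
have d2 x y : (2 * q %| x * y)%N -> (2 %| x * y)%N /\ (q %| x * y)%N.
  by move=> d; split; apply: dvdn_trans d; [apply: dvdn_mulr | apply: dvdn_mull].
have [_ qab] := d2 _ _ (mK _ _ Ba Bb ab); rewrite Gauss_dvdl // in qab.
have [two_ac _] := d2 _ _ (mK _ _ Ba Bc (etrans (congr1 negb (eq_sym a c)) ca)).
rewrite Gauss_dvdr // in two_ac.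
have [_ qbc] := d2 _ _ (mK _ _ Bb Bc (etrans (congr1 negb (eq_sym b c)) cb)).
rewrite Gauss_dvdr // in qbc.
have qqc : (2 * q %| K c)%N by rewrite Gauss_dvd ?two_ac // prime_coprime // dvdn2 q_odd.
move: sumB; rewrite BE -setUA !big_setU1 ?big_set1 ?inE ?negb_or ?ab ?[_ == c]eq_sym ?ca ?cb //=.
case/dvdnP: qab => x xE; case/dvdnP: qqc => y yE.
have := K_gt0 _ Bb; have := K_gt0 _ Bc; have := K_gt0 _ Ba; rewrite xE yE => x_gt0 y_gt0.
have q_gt0 := prime_gt0 q_pr; move=> Kb0 sumK.
have x_odd : odd x by move: Ka; rewrite xE oddM => /andP[].
have xy : (x + 2 * y <= 4)%N.
  rewrite -(leq_pmul2r q_gt0); move: Kb0 sumK; clear; lia.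
have [x1 y1] : x = 1%N /\ y = 1%N.
  have : (0 < y)%N by move: y_gt0; rewrite muln_gt0 => /andP[].
  by move: xy x_odd; clear; case: x => [|[|[|[|]]]] //; lia.
by rewrite x1 y1 in sumK *; move: sumK; clear; split; lia.
Qed.

(** * Powers in F_p and the quadratic character *)

Section FiniteFieldPowers.

Variables (p : nat) (p_pr : prime p).
Implicit Types (i t u : 'F_p).

Lemma fermat_Fp t : t != 0 -> t ^+ p.-1 = 1.
Proof.
move=> tN0; apply: (mulfI tN0); rewrite mulr1 -exprS prednK ?prime_gt0 //.
by have := expf_card t; rewrite card_Fp.
Qed.

(* Multiplication by [t] permutes [M], so it fixes the product of [M].        *)
Lemma expf_stable_set (M : {set 'F_p}) t : 0 \notin M -> t != 0 ->
  (forall i, (t * i \in M) = (i \in M)) -> t ^+ #|M| = 1.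
Proof.
move=> M0 tN0 tM; pose P := \prod_(i in M) i.
have PN0 : P != 0 by apply/prodf_neq0 => i Mi; apply: contraNneq M0 => <-.
apply: (mulIf PN0); rewrite mul1r -prodr_const -big_split /=.
rewrite [RHS](reindex_inj (mulfI tN0)) /=.
by apply: eq_bigl => i; rewrite tM.
Qed.

Variables (h : nat) (p_def : p = (2 * h).+1).

Lemma sqr_eq1 t : t ^+ 2 = 1 -> t = 1 \/ t = -1.
Proof.
by move/eqP; rewrite -subr_eq0 subr_sqr_1 mulf_eq0 subr_eq0 addr_eq0 => /orP[]/eqP; [left|right].
Qed.

Lemma exp_half t : t != 0 -> t ^+ h = 1 \/ t ^+ h = -1.
Proof.
move=> tN0; apply: sqr_eq1; rewrite -exprM.
have -> : (h * 2)%N = p.-1 by lia.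
exact: fermat_Fp.
Qed.

Lemma card_Fp_neq0 : #|[pred g : 'F_p | g != 0]| = p.-1.
Proof.
transitivity #|'F_p|.-1; last by rewrite card_Fp.
by rewrite -(cardC1 (0 : 'F_p)); apply: eq_card => g; rewrite !inE.
Qed.

Lemma h_gt0 : (0 < h)%N.
Proof. by rewrite lt0n; apply: contraTneq p_pr => h0; rewrite p_def h0. Qed.

Lemma Fp_N1_neq1 : -1 != 1 :> 'F_p.
Proof.
rewrite eq_sym -subr_eq0 opprK -[1]/(1%:R) -natrD.
by apply: Fp_ord_neq0; rewrite //= p_def; have := h_gt0; lia.
Qed.

(** The quadratic character by Euler's criterion, with h = (p - 1) / 2; as an element of Z[C_p] it
    is the quadratic Gauss sum. *)
Definition legendre : cgr p :=
  [ffun t => if t == 0 then 0 else if t ^+ h == 1 then 1 else -1].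

Lemma legendre0 : legendre 0 = 0.
Proof. by rewrite ffunE eqxx. Qed.

Lemma legendre1 t : t != 0 -> t ^+ h = 1 -> legendre t = 1.
Proof. by move=> /negPf tN0 th; rewrite ffunE tN0 th eqxx. Qed.

Lemma legendreN1 t : t != 0 -> t ^+ h = -1 -> legendre t = -1.
Proof. by move=> /negPf tN0 th; rewrite ffunE tN0 th (negPf Fp_N1_neq1). Qed.

Lemma legendreM t u : legendre (t * u) = legendre t * legendre u.
Proof.
have [->|tN0] := eqVneq t 0; first by rewrite mul0r legendre0 mul0r.
have [->|uN0] := eqVneq u 0; first by rewrite mulr0 legendre0 mulr0.
have tuN0 : t * u != 0 by rewrite mulf_neq0.
case: (exp_half tN0) => th; case: (exp_half uN0) => uh;
  rewrite ?(legendre1 tN0 th) ?(legendreN1 tN0 th) ?(legendre1 uN0 uh) ?(legendreN1 uN0 uh).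
- by rewrite legendre1 // exprMn th uh mulr1.
- by rewrite legendreN1 // exprMn th uh mul1r.
- by rewrite legendreN1 // exprMn th uh mulr1.
- by rewrite legendre1 // exprMn th uh mulrNN mulr1.
Qed.

Lemma exists_nonresidue : exists2 g : 'F_p, g != 0 & g ^+ h = -1.
Proof.
have [/existsP[g /andP[gN0 /eqP]]|] := boolP [exists g : 'F_p, (g != 0) && (g ^+ h == -1)].
  by exists g.
rewrite negb_exists => /forallP none.
pose rs := enum [pred g : 'F_p | g != 0].
have rs_uniq : uniq rs by apply: enum_uniq.
have size_rs : size rs = p.-1 by rewrite -cardE card_Fp_neq0.
have rs_root : all (root ('X^h - 1)) rs.
  apply/allP => g; rewrite mem_enum inE => gN0.
  rewrite rootE !hornerE subr_eq0; have := none g; rewrite gN0 /=.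
  by case: (exp_half gN0) => ->; rewrite eqxx.
have := max_poly_roots _ rs_root rs_uniq.
by rewrite -size_poly_eq0 size_XnsubC ?h_gt0 // size_rs => /(_ isT); have := h_gt0; lia.
Qed.

Lemma aug_legendre : aug legendre = 0.
Proof.
have [g gN0 gh] := exists_nonresidue.
have : aug legendre = - aug legendre.
  rewrite {1}/aug (reindex_inj (mulfI gN0)) -sumrN; apply: eq_bigr => i _ /=.
  by rewrite legendreM (legendreN1 gN0 gh) mulN1r.
lia.
Qed.

Lemma legendre_sqr : ~~ odd h -> legendre * legendre = p%:~R - cgJ.
Proof.
move=> h_even; have LN1 : legendre (-1) = 1.
  by rewrite legendre1 ?oppr1_neq0 // -signr_odd (negPf h_even).
have L2 t : t != 0 -> legendre t * legendre t = 1.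
  move=> tN0; case: (exp_half tN0) => th; first by rewrite legendre1.
  by rewrite legendreN1.
apply/ffunP=> t; rewrite cgM cgB cgint cgJE.
have [->|tN0] := eqVneq t 0.
  rewrite (bigD1 0) //= legendre0 mul0r add0r.
  rewrite (eq_bigr (fun=> 1)) => [|i iN0].
    rewrite sumr_const mul1r card_Fp_neq0.
    by rewrite natz; have := prime_gt0 p_pr; lia.
  by rewrite sub0r -mulN1r legendreM LN1 mul1r L2.
rewrite mul0r sub0r (bigD1 0) //= legendre0 mul0r add0r.
(* For i nonzero the character at i times that at t - i is the character at t / i - 1, and t / i
   runs over the nonzero residues. *)
transitivity (\sum_(i | i != 0) legendre (t / i - 1)).
  apply: eq_bigr => i iN0.
  have -> : t - i = i * (t / i - 1) by rewrite mulrBr mulr1 mulrCA mulfV // mulr1.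
  by rewrite legendreM mulrA L2 // mul1r.
have inj_i : injective (fun i : 'F_p => t / i).
  by move=> i j /(mulfI tN0)/invr_inj.
rewrite (reindex_inj inj_i) /=.
transitivity (\sum_(i | i != 0) legendre (i - 1)).
  apply: eq_big => [i|i _]; first by rewrite mulf_eq0 (negPf tN0) invr_eq0.
  by rewrite invfM invrK mulrA mulfV // mul1r.
have := aug_legendre; rewrite /aug (reindex_inj (addIr (-1))) (bigD1 0) //= sub0r LN1.
by move/eqP; rewrite addrC addr_eq0 => /eqP.
Qed.

End FiniteFieldPowers.

(** Here x, y, z are the values of a class function on classes of sizes Q, Q + 1, 2Q. After
    elimination of y, the norm equation says that a positive quadratic form in x1 and z1 takes the
    value 6, and its coefficients are too large for that when Q >= 3. *)
Lemma sizes_2q_arith (Q x y z x1 z1 : int) : 3 <= Q ->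
  x * x * Q + y * y * (Q + 1) + z * z * (2 * Q) =
    (4 * Q + 1) * (Q + 1) - (Q + 1) * (Q + 1) ->
  x * Q + y * (Q + 1) + z * (2 * Q) = 0 ->
  x = x1 * (Q + 1) -> z * 2 = z1 * (Q + 1) -> False.
Proof.
move=> Q_ge3 norm aug0 x1E z1E.
have yE : y = - (Q * (x1 + z1)).
  have : (Q + 1) * (y + Q * (x1 + z1)) = 0.
    by have := congr1 (fun w => w * Q) z1E; rewrite x1E in aug0; lia.
  by move/eqP; rewrite mulf_eq0 => /orP[]/eqP; lia.
have main : 2 * (Q + 1) * (x1 * x1) + 2 * Q * ((x1 + z1) * (x1 + z1)) + (Q + 1) * (z1 * z1) = 6.
  have QQ : 2 * (Q * (Q + 1)) != 0 by rewrite !mulf_neq0 //; lia.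
  apply: (mulfI QQ); rewrite yE x1E in norm.
  have zz : 4 * (z * z) = (Q + 1) * (Q + 1) * (z1 * z1).
    have -> : 4 * (z * z) = (z * 2) * (z * 2) by ring.
    by rewrite z1E; ring.
  by have := congr1 (fun w => w * Q) zz; lia.
have sqr_ge0 (u : int) : 0 <= u * u by rewrite -expr2 sqr_ge0.
have sqr_ge1 (u : int) : u != 0 -> 1 <= u * u.
  by move=> uN0; rewrite -gtz0_ge1 -expr2 exprn_even_gt0 ?uN0.
have prod_ge0 (u v : int) : 0 <= u -> 0 <= v -> 0 <= u * v by apply: mulr_ge0.
have Q0 : 0 <= Q - 3 by lia.
have := prod_ge0 _ _ Q0 (sqr_ge0 (x1 + z1)); have := sqr_ge0 (x1 + z1).
have [x0|/sqr_ge1 x1_ge1] := eqVneq x1 0; last first.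
  have := prod_ge0 _ _ Q0 (sqr_ge0 z1); have := sqr_ge0 z1.
  have : 0 <= x1 * x1 - 1 by lia.
  by move/(prod_ge0 _ _ Q0); lia.
rewrite x0 !(mul0r, mulr0, add0r) in main *.
have [z0|/sqr_ge1 z1_ge1] := eqVneq z1 0; first by rewrite z0 in main; lia.
have : 0 <= z1 * z1 - 1 by lia.
by move/(prod_ge0 _ _ Q0); lia.
Qed.

(** * Multipliers of index two in F_p^* *)

Section PureIndexTwo.

Variables (p : nat) (p_pr : prime p) (T : finType) (k : dih p -> T).
Hypothesis kS : Scoloring k.
Hypothesis pure : forall i j, k (false, i) <> k (true, j).

Notation c := (fun i => k (false, i)).
Notation s := (fun i => k (true, i)).

Variables (q : nat) (q_gt2 : (2 < q)%N) (p_def : p = (2 * (2 * q)).+1).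
Hypothesis valency : cvalency k = (2 * q)%N.

(** As M has 2q elements, its members satisfy t^(2q) = 1, so they are squares and preserve the
    quadratic character. *)
Lemma class_fun_legendre : class_fun c (legendre p (2 * q)).
Proof.
move=> i j cij; have [i0|iN0] := eqVneq i 0.
  by rewrite i0 in cij *; rewrite (pure_c0 kS (esym cij)).
have [tN0 ct] := pure_ratio p_pr kS pure cij iN0; set t := j / i in tN0 ct.
have -> : j = t * i by rewrite mulfVK.
have th : t ^+ (2 * q) = 1; last by rewrite legendreM // (legendre1 _ th) ?mul1r.
rewrite -valency; apply: expf_stable_set => // [|l]; rewrite !inE ?ct //.
by apply/eqP=> /esym/(pure_c0 kS)/eqP; rewrite oner_eq0.
Qed.

(* The product [g] of the quadratic character and the class [b] of size       *)
(* [q + 1] is a class function; its values on the two other classes are       *)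
(* divisible by [q + 1], up to a factor 2, which makes its norm too large.    *)
Lemma no_sizes_2q : ~ exists a b e, [/\ scolors k = [set a; b; e], uniq [:: a; b; e] &
  [/\ ssize k a = q, ssize k b = q.+1 & ssize k e = (2 * q)%N]].
Proof.
case=> a [b [e [sE abe [Ka Kb Ke]]]].
have get x : x \in scolors k -> exists j, x = s j by case/imsetP=> j _ ->; exists j.
have [ja aE] : exists j, a = s j by apply: get; rewrite sE !inE eqxx.
have [jb bE] : exists j, b = s j by apply: get; rewrite sE !inE eqxx ?orbT.
have [je eE] : exists j, e = s j by apply: get; rewrite sE !inE eqxx ?orbT.
have aug3 y : class_fun s y -> aug y = y ja * q%:Z + y jb * q.+1%:Z + y je * (2 * q)%:Z.
  move=> sy; have sum1 x j : x = s j -> \sum_(l | s l == x) y l = y j * (ssize k x)%:Z.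
    move=> xE; rewrite (eq_bigr (fun=> y j)) => [|l /eqP slx]; last first.
      by apply: sy; rewrite slx.
    rewrite sumr_const -mulr_natr natz /ssize; congr (_ * Posz _).
    by apply: eq_card => l; rewrite !inE.
  have inner x : \sum_(l in [set: 'F_p] | s l == x) y l = \sum_(l | s l == x) y l.
    by apply: eq_bigl => l; rewrite inE.
  transitivity (\sum_(l in [set: 'F_p]) y l); first by apply: eq_bigl => l; rewrite inE.
  rewrite (partition_big_imset s) -[s @: _]/(scolors k) sE /=.
  have [/negPf ab [/negPf ae /negPf be]] : a != b /\ a != e /\ b != e.
    by move: abe; rewrite /= !inE !negb_or => /andP[/andP[-> ->] /andP[->]].
  rewrite -setUA !big_setU1 ?big_set1 ?inE ?ab ?ae ?be //=.
  by rewrite !inner (sum1 _ _ aE) (sum1 _ _ bE) (sum1 _ _ eE) Ka Kb Ke addrA.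
pose S := legendre p (2 * q).
pose Y x : cgr p := ind [set l | s l == x].
have sY x : class_fun s (Y x) by move=> i j sij; rewrite !indE !inE sij.
have sSY x : class_fun s (S * Y x).
  by apply: pure_csM => //; apply: class_fun_legendre.
have YE x j : Y x j = (s j == x)%:R by rewrite indE inE.
have [/negPf ab [/negPf ae /negPf be]] : a != b /\ a != e /\ b != e.
  by move: abe; rewrite /= !inE !negb_or => /andP[/andP[-> ->] /andP[->]].
have [ba [ea eb]] : (b == a = false) /\ (e == a = false) /\ (e == b = false).
  by rewrite ![_ == a]eq_sym [e == b]eq_sym.
have h_even : ~~ odd (2 * q) by rewrite oddM.
have conjS : conj S = S.
  apply/ffunP=> i; rewrite conjE -mulN1r /S legendreM // legendre1 ?mul1r ?oppr1_neq0 //.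
  by rewrite -signr_odd (negPf h_even).
have inner x y : class_fun s x -> class_fun s y ->
    (conj x * y) 0 = x ja * y ja * q%:Z + x jb * y jb * q.+1%:Z + x je * y je * (2 * q)%:Z.
  move=> sx sy; rewrite conjM0.
  transitivity (aug ([ffun j => x j * y j] : cgr p)); first by apply: eq_bigr => j _; rewrite ffunE.
  by rewrite aug3 ?ffunE // => i j sij; rewrite !ffunE (sx _ _ sij) (sy _ _ sij).
have sym x y : (conj (S * x) * y) 0 = (conj x * (S * y)) 0.
  rewrite conjM conjS.
  by have -> : S * conj x * y = conj x * (S * y) :> cgr p by ring.
pose g := S * Y b.
(* Multiplication by S is self-adjoint. Weighted by class sizes, this exchanges the roles of a and
   b, and later shows that q + 1 divides the value of g on a, and twice its value on e. *)
have eqa : g ja * q%:Z = (S * Y a) jb * q.+1%:Z.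
  have := sym (Y b) (Y a); rewrite !inner // !YE -aE -bE -eE !eqxx ?ab ?ae ?be ?ba ?ea ?eb.
  by rewrite !(mulr0, mulr1, mul0r, mul1r, addr0, add0r).
have eqe : g je * (2 * q)%:Z = (S * Y e) jb * q.+1%:Z.
  have := sym (Y b) (Y e); rewrite !inner // !YE -aE -bE -eE !eqxx ?ab ?ae ?be ?ba ?ea ?eb.
  by rewrite !(mulr0, mulr1, mul0r, mul1r, addr0, add0r).
have aug0 : g ja * q%:Z + g jb * q.+1%:Z + g je * (2 * q)%:Z = 0.
  by rewrite -(aug3 g (sSY b)) /g augM aug_legendre ?mul0r.
have norm : g ja * g ja * q%:Z + g jb * g jb * q.+1%:Z + g je * g je * (2 * q)%:Z
    = p%:Z * q.+1%:Z - q.+1%:Z * q.+1%:Z.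
  have YbK : aug (Y b) = q.+1%:Z by rewrite aug_ind -Kb.
  rewrite -(inner g g (sSY b) (sSY b)) /g conjM conjS.
  have -> : S * conj (Y b) * (S * Y b) = (S * S) * (conj (Y b) * Y b) by ring.
  rewrite legendre_sqr // mulrBl cgJM augM aug_conj YbK mulrC mulrzr cgB !cgMz cgJE.
  by rewrite aug_ind_mul0 YbK; ring.
move: (g ja) (g jb) (g je) ((S * Y a) jb) ((S * Y e) jb) eqa eqe aug0 norm.
move=> x y z x' z' eqa eqe aug0 norm.
have co : coprimez q.+1%:Z q%:Z by rewrite coprimezE /= coprimeSn.
have /dvdzP[x1 x1E] : (q.+1%:Z %| x)%Z by rewrite -(Gauss_dvdzl _ co) eqa dvdz_mull.
have /dvdzP[z1 z1E] : (q.+1%:Z %| z * 2%:Z)%Z.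
  by rewrite -(Gauss_dvdzl _ co) -mulrA -PoszM eqe dvdz_mull.
have q_ge3 : (3%:Z <= q%:Z) by rewrite lez_nat.
have qS : q.+1%:Z = q%:Z + 1 by clear; lia.
have pZ : p%:Z = 4 * q%:Z + 1 by move: p_def; clear; lia.
have q2 : (2 * q)%N%:Z = 2 * q%:Z by clear; lia.
rewrite {}pZ {}q2 {}qS in norm aug0 eqa eqe x1E z1E.
move: (q%:Z) q_ge3 norm aug0 eqa eqe x1E z1E => Q Q_ge3 norm aug0 eqa eqe x1E z1E.
exact: (sizes_2q_arith (Q := Q)) Q_ge3 norm aug0 x1E z1E.
Qed.

End PureIndexTwo.

(** * The multiplier theorem for difference sets *)

Section MultiplierTheorem.

Variables (p : nat) (p_pr : prime p).
Implicit Types (x y z : cgr p) (t : 'F_p).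

Lemma frobenius_iter x l j : prime l -> l%:R != 0 :> 'F_p ->
  dvdr l (x ^+ (l ^ j) - act (l%:R ^+ j) x).
Proof.
move=> l_pr lN0; elim: j => [|j IHj]; first by rewrite act1l expr1 subrr; apply: dvdr0.
rewrite expnS exprM [l%:R ^+ _]exprS -act_act.
have -> : (x ^+ l) ^+ (l ^ j) - act l%:R (act (l%:R ^+ j) x) =
    ((x ^+ (l ^ j)) ^+ l - act l%:R (x ^+ (l ^ j))) + act l%:R (x ^+ (l ^ j) - act (l%:R ^+ j) x).
  by rewrite actB -!exprM (mulnC l); ring.
by apply: dvdrD; [apply: frobenius | apply: dvdr_act].
Qed.

Lemma cg_mulrnI n x y : (0 < n)%N -> x *+ n = y *+ n -> x = y.
Proof.
move=> n_gt0 E; apply/ffunP=> i; have := congr1 (fun w : cgr p => w i) E.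
by rewrite !cgMn => /pmulrnI; apply.
Qed.

Lemma dvdr_idem n m x : dvdr n (x * x - x) -> dvdr n (x ^+ m.+1 - x).
Proof.
move=> xx; elim: m => [|m IHm]; first by rewrite expr1 subrr; apply: dvdr0.
have -> : x ^+ m.+2 - x = x * (x ^+ m.+1 - x) + (x * x - x) by rewrite exprS; ring.
by apply: dvdrD => //; apply: dvdrMl.
Qed.

(* Modulo [l ^ a], the power [E = x ^ ((l ^ f - 1) * l ^ (a - 1))] is an      *)
(* idempotent fixed by [act l] and generating the same ideal as [x] mod [l];  *)
(* so [x] can be replaced by [(1 - E) * x], a multiple of [l].                *)
Lemma multiplier_pow l f a x y : prime l -> (0 < f)%N -> l%:R ^+ f = 1 :> 'F_p ->
  dvdr (l ^ a) (x * y) -> dvdr (l ^ a) (act l%:R x * y).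
Proof.
move=> l_pr f_gt0 lf; have lN0 : l%:R != 0 :> 'F_p.
  by apply: contra_eq_neq lf => ->; rewrite expr0n gtn_eqF // eq_sym oner_eq0.
have l_gt1 := prime_gt1 l_pr.
have [m mE] : exists m, (l ^ f = m.+2)%N.
  by exists (l ^ f).-2; have := ltn_expl f l_gt1; lia.
elim: a x => [|a IHa] x xy; first by exists (act l%:R x * y); rewrite mulr1n.
(* Since l^f = 1 mod p, x^(l^f) is congruent to x mod l, so e = x^(l^f - 1) is idempotent mod l. *)
pose e := x ^+ m.+1; pose E := e ^+ (l ^ a).
have xl : dvdr l (x ^+ m.+2 - x) by have := frobenius_iter x f l_pr lN0; rewrite lf act1l mE.
have ex : dvdr l (e * x - x) by rewrite -exprSr.
have ee : dvdr l (e * e - e).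
  have -> : e * e - e = x ^+ m * (x ^+ m.+2 - x).
    by rewrite mulrBr -exprSr -!exprD; congr (_ ^+ _ - _); lia.
  exact: dvdrMl.
have ale : dvdr l (act l%:R e - e).
  have -> : act l%:R e - e = (e ^+ l - e) - (e ^+ l - act l%:R e) by ring.
  apply: dvdrB; last exact: frobenius.
  by rewrite -(prednK (prime_gt0 l_pr)); apply: dvdr_idem; rewrite prednK ?prime_gt0.
have aE : dvdr (l ^ a.+1) (act l%:R E - E).
  by rewrite actX //; apply: dvdr_lift.
have EY : dvdr (l ^ a.+1) (E * y).
  have [n nE] : exists n, (m.+1 * l ^ a = n.+1)%N.
    by exists (m.+1 * l ^ a).-1; have := expn_gt0 l a; nia.
  by rewrite /E -exprM nE exprSr -mulrA; apply: dvdrMl.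
have [x' x'E] : dvdr l ((1 - E) * x).
  have -> : (1 - E) * x = - ((E - e) * x + (e * x - x)) by ring.
  apply/dvdrN/dvdrD => //; apply: dvdrMr; rewrite /E.
  by have := expn_gt0 l a; case: (l ^ a)%N => [|n _]; [lia | apply: dvdr_idem].
have x'y : dvdr (l ^ a) (x' * y).
  have [w wE] : dvdr (l ^ a.+1) ((1 - E) * x * y).
    have -> : (1 - E) * x * y = x * y - x * (E * y) by ring.
    by apply: dvdrB => //; apply: dvdrMl.
  exists w; apply: (@cg_mulrnI l); first exact: prime_gt0.
  by rewrite -mulrnA -expnSr -wE x'E mulrnAl.
have -> : act l%:R x * y =
    act l%:R ((1 - E) * x) * y + (act l%:R x * (act l%:R E - E) * y + act l%:R x * (E * y)).
  by rewrite actM // actB act1 //; ring.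
apply: dvdrD; last by apply: dvdrD; [apply/dvdrMr/dvdrMl | apply: dvdrMl].
rewrite x'E actMn mulrnAl.
by have [w ->] := IHa _ x'y; exists w; rewrite -mulrnA expnSr.
Qed.

Section DifferenceSet.

Variables (X : {set 'F_p}) (n lam : nat).
Notation x := (ind X).
Notation k := #|X|.
Hypotheses (lam_lt_n : (lam < n)%N) (n_lt_p : (n < p)%N).
Hypothesis xx : conj x * x = n%:~R + cgJ *~ lam.

Lemma diffset_card : k = (n + lam)%N.
Proof.
have := congr1 (fun w : cgr p => w 0) xx.
by rewrite aug_ind_mul0 aug_ind cgD cgint cgMz cgJE eqxx !mul1r => -[].
Qed.

Lemma diffset_sqr : (k * k = n + lam * p)%N.
Proof.
have := congr1 (@aug p) xx.
by rewrite augM aug_conj aug_ind augD aug_int augMz augJ //; clear; lia.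
Qed.

Lemma ind_ge0 i : 0 <= x i. Proof. by rewrite indE; case: (i \in X). Qed.

Lemma prime_dvd_neq0 l : prime l -> (l %| n)%N -> l%:R != 0 :> 'F_p.
Proof.
move=> l_pr ln; apply: Fp_ord_neq0 => //; rewrite prime_gt0 //=.
by apply: leq_ltn_trans n_lt_p; apply: dvdn_leq => //; lia.
Qed.

(* If [l ^ j = -1] then [x ^ (l ^ j + 1)] is congruent to [conj x * x], hence *)
(* to a multiple of [J], mod [l]; so is [x] itself, which is an absurdity.    *)
Lemma prime_dvd_no_N1 l j : prime l -> (l %| n)%N -> l%:R ^+ j != -1 :> 'F_p.
Proof.
move=> l_pr ln; apply/negP=> /eqP lj; have lN0 := prime_dvd_neq0 l_pr ln.
have l_gt1 := prime_gt1 l_pr.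
have lj_gt0 : (0 < l ^ j)%N by rewrite expn_gt0 prime_gt0.
have p_gt2 : (2 < p)%N by have := dvdn_leq _ ln; lia.
have j_gt0 : (0 < j)%N.
  rewrite lt0n; apply: contra_eq_neq lj => ->; rewrite expr0 -subr_eq0 opprK.
  by rewrite -[1]/(1%:R) -natrD; apply: Fp_ord_neq0; rewrite // ltnW.
have x1 : dvdr l (x ^+ (l ^ j).+1 - cgJ *~ lam).
  have -> : x ^+ (l ^ j).+1 - cgJ *~ lam =
      (x ^+ (l ^ j) - conj x) * x + (conj x * x - cgJ *~ lam) by rewrite exprSr; ring.
  apply: dvdrD; first by apply: dvdrMr; rewrite /conj -lj; apply: frobenius_iter.
  rewrite xx addrK; apply: (dvdr_nat ln).
  by exists 1; rewrite -pmulrn.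
have [m mE] : exists m, (l ^ (j + j) = (l ^ j).+1 + m)%N.
  by exists (l ^ (j + j) - (l ^ j).+1)%N; rewrite expnD; have := ltn_expl j l_gt1; nia.
have x2 : dvdr l (x - cgJ *~ (lam%:Z * aug (x ^+ m))).
  have F := frobenius_iter x (j + j) l_pr lN0.
  rewrite exprD lj mulrNN mulr1 act1l mE exprD in F.
  have := dvdrB (dvdrMr (x ^+ m) x1) F.
  rewrite mulrBl mulrzAl cgJM -mulrzA mulrC; congr dvdr.
  by rewrite [aug _ * _]mulrC; ring.
have k_gt0 : (0 < k)%N by rewrite diffset_card; lia.
have k_lt : (k < p)%N.
  by have := diffset_sqr; have := diffset_card; nia.
have [i Xi] : exists i, i \in X by apply/set0Pn; rewrite -card_gt0.
have [i' Xi'] : exists i', i' \notin X.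
  have : (0 < #|~: X|)%N by have := cardsC X; rewrite card_Fp //; lia.
  by rewrite card_gt0 => /set0Pn[i']; rewrite inE; exists i'.
have := dvdrB (dvdr_cg i x2) (dvdr_cg i' x2).
rewrite !cgB !cgMz !cgJE !indE Xi (negPf Xi') => /dvdr_int.
set u := 1 * _; have -> : true%:R - u - (false%:R - u) = 1 :> int by lia.
by rewrite dvdzE dvdn1 => /eqP; lia.
Qed.

Lemma dvdz_all_prime_powers (m : nat) (z : int) : (0 < m)%N ->
  (forall l, prime l -> (l %| m)%N -> ((l ^ logn l m)%N %| z)%Z) -> (m %| z)%Z.
Proof.
move=> m_gt0 H; rewrite dvdzE; apply/dvdn_partP => //= l.
rewrite mem_primes => /and3P[l_pr _ lm]; rewrite p_part.
by have := H l l_pr lm; rewrite dvdzE.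
Qed.

(** The coefficients of z = act t x * conj x are non-negative and congruent to lam mod n. As lam <
    n, each is lam + n e_i with e_i >= 0, and the augmentation makes the e_i sum to 1. So z = lam J
    + n r^b, and multiplying by x and cancelling n gives the translate. *)
Lemma diffset_multiplier t :
    (forall l, prime l -> (l %| n)%N -> exists2 f, (0 < f)%N & l%:R ^+ f = 1 :> 'F_p) ->
    (forall l, prime l -> (l %| n)%N -> exists j, t = l%:R ^+ j) -> t != 0 ->
  exists b, act t x = cgd b * x.
Proof.
move=> ord_l pow_l tN0.
(* This y makes x * y = n (p - J), because k^2 = n + lam p; the multiple of J in conj x * x thus
   becomes divisible by n. *)
pose y : cgr p := conj x *~ p - cgJ *~ k.
have xy : dvdr n (x * y).
  exists (p%:~R - cgJ); rewrite /y mulrBr mulrzAr mulrC xx mulrzAr [x * _]mulrC cgJM aug_ind.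
  apply/ffunP=> i; rewrite !(cgD, cgN, cgMn, cgMz, cgint, cgJE).
  by have := diffset_sqr => E; rewrite -mulr_natr natz; case: (i == 0); lia.
have txy i : (n %| (act t x * y) i)%Z.
  have n_gt0 : (0 < n)%N by lia.
  apply: dvdz_all_prime_powers => // l l_pr ln.
  have [f f_gt0 lf] := ord_l l l_pr ln; have [j ->] := pow_l l l_pr ln.
  apply/dvdr_int/dvdr_cg; elim: j => [|j IHj].
    by rewrite act1l; apply: dvdr_nat xy; apply: pfactor_dvdnn.
  by rewrite exprS -act_act; apply: (multiplier_pow l_pr f_gt0 lf).
pose z := act t x * conj x.
have z_ge0 i : 0 <= z i.
  rewrite cgM; apply: sumr_ge0 => j _; rewrite mulr_ge0 // ?conjE ?actE ind_ge0 //.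
have zlam i : (n %| z i - lam%:Z)%Z.
  have co : coprimez n p by rewrite coprimezE /= coprime_sym prime_coprime // gtnNdvd //; lia.
  rewrite -(Gauss_dvdzr _ co); have := txy i.
  rewrite /y mulrBr mulrzAr -/z mulrzAr [act t x * _]mulrC cgJM aug_act // aug_ind.
  rewrite !(cgB, cgMz, cgJE) => d.
  have -> : p%:Z * (z i - lam%:Z) = (z i * p - 1 * k%:Z * k) + n%:Z.
    by have := diffset_sqr; lia.
  by rewrite rpredD // dvdzz.
have zE i : exists e : nat, z i = lam%:Z + n%:Z * e%:Z.
  have /dvdzP[e eE] := zlam i; have := z_ge0 i => zi.
  have e_ge0 : 0 <= e by move: zi eE lam_lt_n; clear; nia.
  exists `|e|%N; rewrite gez0_abs; lia.
have [e eP] : exists e : 'F_p -> nat, forall i, z i = lam%:Z + n%:Z * (e i)%:Z.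
  by have [e eP] := fin_all_exists zE; exists e.
have sum_e : (\sum_i e i = 1)%N.
  have : aug z = (k * k)%N by rewrite augM aug_act // aug_conj !aug_ind.
  rewrite /aug (eq_bigr _ (fun i _ => eP i)) big_split /= sumr_const card_Fp //.
  rewrite -mulr_sumr => E.
  have S : \sum_i (e i)%:Z = (\sum_i e i)%N%:Z.
    by rewrite -natz natr_sum; apply: eq_bigr => i _; rewrite natz.
  rewrite S diffset_sqr -mulr_natr natz in E.
  by move: lam_lt_n E; move: (\sum_i e i)%N; clear; nia.
have [b eb] : exists b, (0 < e b)%N.
  apply/existsP; apply: contra_eqT sum_e; rewrite negb_exists => /forallP e0.
  by rewrite big1 // => i _; apply/eqP; have := e0 i; rewrite lt0n negbK.
have eE i : e i = (i == b) :> nat.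
  move: sum_e; rewrite (bigD1 b) //= => sum_e.
  have e0 : (\sum_(i | i != b) e i = 0)%N.
    by case: (e b) eb sum_e => // m _ /eqP; rewrite addSn eqSS addn_eq0 => /andP[_ /eqP].
  have [->|ib] := eqVneq i b; first by rewrite e0 addn0 in sum_e.
  by move/eqP: e0; rewrite sum_nat_eq0 => /forallP/(_ i); rewrite ib => /eqP.
exists b; apply: (@cg_mulrnI n); first by lia.
have zJ : z = cgJ *~ lam + cgd b *+ n.
  apply/ffunP=> i; rewrite eP cgD cgMz cgJE cgMn ffunE eE -mulr_natr natz.
  by case: (i == b); lia.
have E1 : z * x = act t x *+ n + cgJ *~ (lam * k).
  have -> : z * x = act t x * n%:~R + (cgJ * act t x) *~ lam.
    rewrite /z -mulrA xx mulrDr; congr (_ + _).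
    by apply: etrans (mulrzAr _ _ _) _; rewrite mulrC.
  by rewrite cgJM aug_act // aug_ind mulrzr -pmulrn -mulrzA (mulrC k%:Z).
have E2 : z * x = cgJ *~ (lam * k) + (cgd b * x) *+ n.
  by rewrite zJ mulrDl mulrzAl cgJM aug_ind -mulrzA (mulrC k%:Z) mulrnAl.
by apply: (addIr (cgJ *~ (lam * k))); rewrite -E1 E2 addrC.
Qed.

End DifferenceSet.

End MultiplierTheorem.

(** * Difference sets and quartic residues *)

Section QuarticResidues.

Variables (p : nat) (p_pr : prime p) (q : nat) (q_pr : prime q) (q_odd : odd q).
Hypothesis p_def : p = (2 * (2 * q)).+1.
Implicit Types (i t u : 'F_p).

Notation S := (legendre p (2 * q)).

Definition qres : cgr p := ind [set i | i ^+ q == 1].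

Lemma qresE i : qres i = (i ^+ q == 1)%:R.
Proof. by rewrite indE inE. Qed.

Lemma expN_odd i : (- i) ^+ q = - i ^+ q.
Proof. by rewrite exprNn -signr_odd q_odd mulN1r. Qed.

Lemma exp0_q : (0 : 'F_p) ^+ q = 0.
Proof. by rewrite expr0n gtn_eqF ?prime_gt0. Qed.

Lemma N1_neq1 : (-1 == 1 :> 'F_p) = false.
Proof. exact: negbTE (Fp_N1_neq1 p_pr p_def). Qed.

Lemma exp_q_cases u : u != 0 ->
  [\/ u ^+ q = 1 /\ S u = 1, u ^+ q = -1 /\ S u = 1 | u ^+ (2 * q) = -1 /\ S u = -1].
Proof.
move=> uN0; case: (exp_half p_pr p_def uN0) => uh; last first.
  by constructor 3; rewrite legendreN1.
have Su : S u = 1 by rewrite legendre1.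
rewrite mulnC exprM in uh; case: (sqr_eq1 uh) => uq.
  by constructor 1.
by constructor 2.
Qed.

(** As q is odd, -1 is a square but not a fourth power, so the quartic residues and their opposites
    partition the nonzero squares. *)
Lemma qres_sum : (qres + conj qres) *+ 2 = S + cgJ - 1.
Proof.
apply/ffunP=> i; rewrite cgMn !(cgB, cgD) cgJE cg1 conjE !qresE expN_odd.
have [->|iN0] := eqVneq i 0.
  by rewrite exp0_q oppr0 legendre0 eq_sym oner_eq0.
case: (exp_q_cases iN0) => [[iq ->]|[iq ->]|[iq ->]].
- by rewrite iq eqxx N1_neq1.
- by rewrite iq opprK eqxx N1_neq1.
have neq b : i ^+ q = b -> b ^+ 2 = 1 -> False.
  by move=> <-; rewrite -exprM mulnC iq => /eqP; rewrite N1_neq1.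
case: eqP => [/neq H|_]; first by case: H; rewrite expr1n.
rewrite eqr_oppLR; case: eqP => [/neq H|_] //.
by case: H; rewrite sqrrN expr1n.
Qed.

Lemma act_qres t : t ^+ q = 1 -> act t qres = qres.
Proof.
by move=> tq; apply/ffunP=> i; rewrite actE !qresE exprMn exprVn tq invr1 mul1r.
Qed.

(* With [iota ^ 2 = -1], the product [W] of [A = H - conj H] and of its image *)
(* by [iota] is anti-invariant under [iota], hence an integer multiple [c * S] *)
(* of the quadratic character; the equation computes [16 * W ^ 2] in two ways. *)
Lemma quartic_equation (n lam : nat) (e : int) : e * e = e ->
    conj (qres + e%:~R) * (qres + e%:~R) = n%:~R + cgJ *~ lam ->
  exists c : int, (p%:Z + 1 - 16 * n%:Z + 8 * e) * (p%:Z + 1 - 16 * n%:Z + 8 * e)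
    - (8 * e - 2) * (8 * e - 2) * p%:Z = 16 * (c * c) * p%:Z.
Proof.
move=> ee hh; have [g gN0 gh] := exists_nonresidue p_pr p_def.
pose iota := g ^+ q; have iota2 : iota * iota = -1 by rewrite -expr2 -exprM mulnC.
have iN0 : iota != 0 by rewrite expf_neq0.
have Siota : S iota = -1.
  by apply: legendreN1 => //; rewrite exprM expr2 iota2 -signr_odd q_odd.
have act_iota w i : act iota w (iota * i) = w i by rewrite actE mulKf.
pose A := qres - conj qres; pose B := act iota A; pose W := A * B.
have conjA : conj A = - A by rewrite /A /conj actB -/(conj _) -/(conj _) conjK opprB.
have actB' : act iota B = - A by rewrite /B act_act iota2.
have actW : act iota W = - W by rewrite /W actM // actB' -/B mulrN mulrC.
have WN i : W (iota * i) = - W i.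
  by rewrite -[W i](act_iota W) actW cgN opprK.
have WNN i : W (- i) = W i.
  by rewrite -[- i]mulN1r -iota2 -mulrA !WN opprK.
pose c := W 1.
have Wres u : u ^+ q = 1 -> W u = c.
  move=> uq; have uN0 : u != 0.
    by apply: contra_eq_neq uq => ->; rewrite exp0_q eq_sym oner_neq0.
  have actA : act u A = A by rewrite /A actB /conj act_act mulrC -act_act act_qres.
  have actB2 : act u B = B by rewrite /B act_act (mulrC u) -act_act actA.
  have actWu : act u W = W by rewrite /W actM // actA actB2.
  by rewrite -[u]mulr1 -{1}actWu actE mulKf.
have W0 : W 0 = 0 by have := WN 0; rewrite mulr0; move: (W 0) => w; clear; lia.
have Wsq u : u ^+ q = 1 \/ u ^+ q = -1 -> W u = c.
  by case=> uq; [apply: Wres | rewrite -WNN Wres // expN_odd uq opprK].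
have WS : W = S *~ c.
  apply/ffunP=> u; rewrite cgMz; have [->|uN0] := eqVneq u 0.
    by rewrite W0 legendre0 mul0r.
  case: (exp_q_cases uN0) => [[uq ->]|[uq ->]|[uq ->]].
  - by rewrite mul1r Wsq //; left.
  - by rewrite mul1r Wsq //; right.
  have := WN u; rewrite Wsq; first by rewrite mulN1r => ->; rewrite opprK.
  apply: sqr_eq1; rewrite -exprM mulnC exprMn uq exprM expr2 iota2.
  by rewrite -signr_odd q_odd mulrNN mulr1.
have h_even : ~~ odd (2 * q) by rewrite oddM.
have SS := legendre_sqr p_pr p_def h_even.
have SJ : S * cgJ = 0 by rewrite mulrC cgJM aug_legendre.
have JJ : cgJ * cgJ = p%:~R * cgJ :> cgr p.
  by rewrite cgJM augJ // -[in RHS]mulrC mulrzr.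
(* a, b and G are the coordinates of 4 A^2 on 1, S and J. *)
pose a : int := p%:Z + 1 - 16 * n%:Z + 8 * e.
pose b : int := 8 * e - 2.
pose G : int := p%:Z - 3 - 16 * lam%:Z + 8 * e.
pose E : cgr p := e%:~R; pose N : cgr p := n%:~R; pose L : cgr p := lam%:~R.
pose P : cgr p := p%:~R.
have EE : E * E = E by rewrite /E -intrM ee.
have hE : conj qres * qres = N + cgJ * L - E * (qres + conj qres) - E.
  have LJ : cgJ *~ lam = cgJ * L by rewrite /L mulrzr.
  rewrite LJ conjD conj_int -/E -/N in hh.
  have -> : conj qres * qres = (conj qres + E) * (qres + E) - E * (qres + conj qres) - E * E by ring.
  by rewrite hh EE.
have aE : a%:~R = P + 1 - 16 * N + 8 * E by rewrite /a /P /N /E; ring.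
have bE : b%:~R = 8 * E - 2 by rewrite /b /E; ring.
have GE : G%:~R = P - 3 - 16 * L + 8 * E by rewrite /G /P /L /E; ring.
have A2 : 4 * (A * A) = a%:~R + b%:~R * S + G%:~R * cgJ.
  pose Q := qres + conj qres.
  have Q2 : 2 * Q = S + cgJ - 1 by rewrite -qres_sum mulr_natl.
  have -> : 4 * (A * A) = (2 * Q) * (2 * Q) - 16 * (conj qres * qres) by rewrite /A /Q; ring.
  have -> : 16 * (conj qres * qres) = 16 * (N + cgJ * L) - 8 * E * (2 * Q) - 16 * E.
    by rewrite hE /Q; ring.
  rewrite Q2 aE bE GE.
  have -> : (S + cgJ - 1) * (S + cgJ - 1) =
      S * S + cgJ * cgJ + 1 + 2 * (S * cgJ) - 2 * S - 2 * cgJ by ring.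
  by rewrite SS SJ JJ -/P; ring.
have actS : act iota S = - S.
  apply/ffunP=> i; rewrite actE cgN.
  have -> : S i = S (iota * (iota^-1 * i)) by rewrite mulVKf.
  by rewrite legendreM // Siota mulN1r opprK.
have B2 : 4 * (B * B) = a%:~R - b%:~R * S + G%:~R * cgJ.
  have := congr1 (act iota) A2.
  rewrite !actD !actM // actS actJ !act_int // mulrN => <-.
  by rewrite /B; congr (_ * _); symmetry; exact: (act_int iN0 4).
have key : (a * a - b * b * p%:Z - 16 * (c * c) * p%:Z)%:~R
    = cgJ * (- (b * b + 2 * a * G + G * G * p%:Z + 16 * (c * c)))%:~R :> cgr p.
  have WW : 16 * (W * W) = 16 * (c%:~R * c%:~R) * (P - cgJ).
    by rewrite WS -mulrzr -SS; ring.
  have : 16 * (W * W) = (4 * (A * A)) * (4 * (B * B)) by rewrite /W; ring.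
  rewrite WW A2 B2.
  have -> : (a%:~R + b%:~R * S + G%:~R * cgJ) * (a%:~R - b%:~R * S + G%:~R * cgJ) =
     a%:~R * a%:~R - b%:~R * b%:~R * (S * S) + 2 * a%:~R * G%:~R * cgJ
       + G%:~R * G%:~R * (cgJ * cgJ) by ring.
  rewrite SS JJ -/P; set l := (X in X = _ -> _); set r := (X in _ = X -> _) => EQ.
  apply: subr0_eq; transitivity (r - l); last by rewrite EQ subrr.
  by rewrite /r /l /P; ring.
(* An integer that is a multiple of J in Z[C_p] is 0, by comparison of the coefficients at 0 and
   1. *)
exists c; rewrite -/a -/b.
have := congr1 (fun w : cgr p => w 1) key; have := congr1 (fun w : cgr p => w 0) key.
rewrite mulrzr !cgint !cgMz !cgJE eqxx oner_eq0 !mul1r mul0r.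
by move=> e0 e1; apply: subr0_eq; rewrite e0 -e1.
Qed.

(** Counting gives 4 lam = q + 2e - 1, which reduces the equation to 4p - (8e - 2)^2 = 16 c^2. For e
    = 0 the prime q would be c^2. For e = 1, q = c^2 + 2: if 3 divides c then 3 divides p, which is
    impossible, and otherwise 3 divides q. *)
Lemma quartic_arith (n lam : nat) (e c : int) (k := (q%:Z + e)) :
    e = 0 \/ e = 1 -> k = n%:Z + lam%:Z -> k * k = n%:Z + lam%:Z * p%:Z ->
    (p%:Z + 1 - 16 * n%:Z + 8 * e) * (p%:Z + 1 - 16 * n%:Z + 8 * e)
      - (8 * e - 2) * (8 * e - 2) * p%:Z = 16 * (c * c) * p%:Z ->
  e = 1 /\ q = 3.
Proof.
rewrite /k => {k} e01 k1 k2 eqc.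
have q_gt0 := prime_gt0 q_pr.
have pZ : p%:Z = 4 * q%:Z + 1 by move: p_def; clear; lia.
have pN0 : p%:Z != 0 by have := prime_gt0 p_pr; rewrite eqz_nat; lia.
have qN0 : q%:Z != 0 by rewrite eqz_nat; lia.
have lamE : 4 * lam%:Z = q%:Z + 2 * e - 1.
  apply: (mulfI qN0); rewrite pZ in k2; move: k1 k2; clear -e01.
  by case: e01 => ->; lia.
have aE : p%:Z + 1 - 16 * n%:Z + 8 * e = - 2 * p%:Z by move: lamE k1 pZ; clear; lia.
have {eqc} : 4 * p%:Z - (8 * e - 2) * (8 * e - 2) = 16 * (c * c).
  by apply: (mulIf pN0); rewrite aE in eqc; move: eqc; clear; lia.
have cc : c * c = `|c|%:Z * `|c|%:Z by rewrite -PoszM -abszM gez0_abs // -expr2 sqr_ge0.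
case: e01 => ->; rewrite pZ cc => E.
  have qE : q = (`|c| * `|c|)%N by move: E; clear; lia.
  case/primeP: q_pr => q_gt1 /(_ `|c|%N); rewrite {1}qE dvdn_mulr // => /(_ isT)/orP[]/eqP cE.
    by rewrite qE cE in q_gt1.
  by rewrite cE in qE; move: qE q_gt1; clear; nia.
split=> //; have qE : q = (`|c| * `|c| + 2)%N by move: E; clear; lia.
have [/dvdnP[d dE]|nd3] := boolP (3 %| `|c|)%N.
  have : (3 %| p)%N by apply/dvdnP; exists (12 * d * d + 3)%N; rewrite p_def qE dE; lia.
  rewrite dvdn_prime2 // => /eqP p3; move: p_def; rewrite -p3 qE; clear; lia.
have : (3 %| q)%N.
  rewrite qE /dvdn -modnDml -modnMm; move: nd3; rewrite /dvdn.
  by have := ltn_pmod `|c| (isT : 0 < 3)%N; case: (_ %% 3)%N => [|[|[|]]].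
by rewrite dvdn_prime2 // => /eqP.
Qed.

(** A prime l dividing n has l^(2q) = 1, and -1 is not a power of l, so l has order exactly q mod p
    and generates the quartic residues. These are therefore multipliers, and a suitable translate of
    X is a union of their orbits. *)
Lemma quartic_diffset (X : {set 'F_p}) (n lam : nat) :
    conj (ind X) * ind X = n%:~R + cgJ *~ lam -> #|X| = q \/ #|X| = q.+1 ->
  q = 3 /\ exists a d : 'F_p, a != 0 /\
    forall i, (a * i - d \in X) = (i ^+ q == 1) || (i == 0).
Proof.
move=> xx cardX; have q_gt2 : (2 < q)%N.
  by have := prime_gt1 q_pr; move: q_odd; case: q => [|[|[|]]].
have k1 := diffset_card xx; have k2 := diffset_sqr p_pr xx.
have lamE : (4 * lam = q - 1 /\ #|X| = q \/ 4 * lam = q + 1 /\ #|X| = q.+1)%N.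
  case: cardX => cX; [left | right]; split=> //; rewrite cX in k1 k2;
    apply/eqP; rewrite -(eqn_pmul2l (prime_gt0 q_pr)) ?mulnBr; apply/eqP;
    move: k1 k2 p_def; clear; nia.
have lam_lt_n : (lam < n)%N by lia.
have n_lt_p : (n < p)%N by lia.
have n_gt1 : (1 < n)%N by lia.
have noN1 := prime_dvd_no_N1 p_pr lam_lt_n n_lt_p xx.
have ord_q l : prime l -> (l %| n)%N -> q.-primitive_root (l%:R : 'F_p).
  move=> l_pr ln; have lN0 := prime_dvd_neq0 p_pr lam_lt_n n_lt_p l_pr ln.
  have lq : l%:R ^+ q = 1 :> 'F_p.
    case: (exp_half p_pr p_def lN0) => [|/eqP]; last by rewrite (negPf (noN1 _ _ l_pr ln)).
    rewrite mulnC exprM => /sqr_eq1[] // /eqP.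
    by rewrite (negPf (noN1 _ _ l_pr ln)).
  have [m m_prim mq] := prim_order_exists (prime_gt0 q_pr) lq.
  move: (q_pr) => /primeP[_ /(_ m mq)] /orP[]/eqP mE; last by rewrite -mE.
  move: (prim_expr_order m_prim); rewrite mE expr1 => /eqP; rewrite -subr_eq0.
  have l_gt1 := prime_gt1 l_pr; have l_le : (l <= n)%N by apply: dvdn_leq; lia.
  rewrite -[1]/(1%:R) -natrB ?(ltnW l_gt1) // (negPf (Fp_ord_neq0 p_pr _)) //.
  by lia.
pose l0 := pdiv n; have l0_pr : prime l0 by apply: pdiv_prime.
pose t0 : 'F_p := l0%:R; have t0_prim : q.-primitive_root t0 by apply: ord_q; rewrite ?pdiv_dvd.
have t0N0 : t0 != 0 by exact: (prime_dvd_neq0 p_pr lam_lt_n n_lt_p l0_pr (pdiv_dvd n)).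
have t0q : t0 ^+ q = 1 := prim_expr_order t0_prim.
have t0N1 : t0 - 1 != 0.
  rewrite subr_eq0; apply/eqP=> t01; have := prim_order_dvd t0_prim 1.
  by rewrite expr1 t01 eqxx dvdn1 => /eqP q1; move: q_pr; rewrite q1.
have [b xb] : exists b, act t0 (ind X) = cgd b * ind X.
  apply: (diffset_multiplier p_pr lam_lt_n n_lt_p xx) => // l l_pr ln.
    by exists q; [apply: prime_gt0 | apply: prim_expr_order; apply: ord_q].
  by have [j ->] := prim_rootP (ord_q l l_pr ln) t0q; exists j.
(* The translation by d is chosen so that t0 fixes the translate instead of shifting it by b. *)
pose d := - b / (t0 - 1); pose y := cgd d * ind X.
have t0y : act t0 y = y.
  rewrite /y actM // actd // xb mulrA -cgdD; congr (cgd _ * _).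
  have : (t0 - 1) * d = - b by rewrite mulrC divfK.
  by rewrite mulrBl mul1r => /eqP; rewrite subr_eq addrC => /eqP->; rewrite addrNK.
have actj j : act (t0 ^+ j) y = y.
  by elim: j => [|j IHj]; rewrite ?act1l // exprS -act_act IHj.
have Hy t i : t ^+ q = 1 -> y (t * i) = y i.
  move=> tq; have [j tE] := prim_rootP t0_prim tq.
  have tN0 : t != 0 by rewrite tE expf_neq0.
  by rewrite -{1}(actj j) -tE actE mulKf.
have yE i : y i = (i - d \in X)%:R by rewrite /y cgdM indE.
have [a aN0 ya] : exists2 a, a != 0 & y a = 1.
  have : (1 < #|X|)%N by lia.
  case/card_gt1P=> i [j [Xi Xj ij]]; have [id0|] := eqVneq (i + d) 0; last first.
    by exists (i + d); rewrite // yE addrK Xi.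
  exists (j + d); last by rewrite yE addrK Xj.
  by rewrite -id0 (inj_eq (addIr d)) eq_sym.
pose x := act a^-1 y.
have xE i : x i = (a * i - d \in X)%:R by rewrite /x actE invrK yE.
have x1 u : u ^+ q = 1 -> x u = 1 by move=> uq; rewrite /x actE invrK mulrC Hy.
have Hx t i : t ^+ q = 1 -> x (t * i) = x i.
  by move=> tq; rewrite /x !actE invrK mulrCA Hy.
have card_qres : #|[set i : 'F_p | i ^+ q == 1]| = q.
  have -> : [set i : 'F_p | i ^+ q == 1] = [set t0 ^+ (j : 'I_q) | j : 'I_q].
    apply/setP=> i; rewrite inE; apply/idP/imsetP => [/eqP iq|[j _ ->]].
      by have [j ->] := prim_rootP t0_prim iq; exists j.
    by rewrite -exprM mulnC exprM t0q expr1n.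
  rewrite card_imset ?card_ord // => i j /eqP.
  by rewrite (eq_prim_root_expr t0_prim) !modn_small // => /eqP/val_inj.
(* At most one point is left over. It must be 0, since with a nonzero i the point t0 i would be left
   over too. *)
pose w := x - qres.
have wE i : w i = ((a * i - d \in X) && (i ^+ q != 1))%:R.
  rewrite /w cgB qresE xE; have [iq|_] := eqVneq (i ^+ q) 1.
    by have := x1 i iq; rewrite xE andbF => ->.
  by rewrite subr0 andbT.
have w_ge0 i : 0 <= w i by rewrite wE; case: (_ && _).
have aug_w : aug w = #|X|%:Z - q%:Z.
  by rewrite /w augB aug_act ?invr_eq0 // augM augd mul1r !aug_ind card_qres.
have aug_w1 : aug w <= 1 by rewrite aug_w; case: cardX => ->; clear; lia.
have w0 i : i != 0 -> w i = 0.
  move=> iN0; rewrite wE; case: (boolP (_ && _)) => // wi1.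
  have wi : w i = 1 by rewrite wE wi1.
  have wti : w (t0 * i) = 1.
    by rewrite -wi /w !cgB Hx // !qresE exprMn t0q mul1r.
  have tiN : t0 * i != i.
    by rewrite -subr_eq0 -{2}[i]mul1r -mulrBl mulf_neq0.
  have : 2 <= aug w.
    rewrite /aug (bigD1 i) //= (bigD1 (t0 * i)) //= wi wti addrA ler_wpDr //.
    by apply: sumr_ge0 => l _.
  by move/le_trans/(_ aug_w1).
pose e := w 0.
have we : w = e%:~R.
  apply/ffunP=> i; rewrite cgint; have [->|iN0] := eqVneq i 0; first by rewrite mul1r.
  by rewrite mul0r w0.
have eE : #|X|%:Z = q%:Z + e by move: aug_w; rewrite we aug_int; move: (e) #|X|; clear; lia.
have e01 : e = 0 \/ e = 1 by case: cardX eE => ->; move: (e); clear; lia.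
have xw : x = qres + e%:~R by rewrite -we /w addrC subrK.
have xx' : conj (qres + e%:~R) * (qres + e%:~R) = n%:~R + cgJ *~ lam.
  have yy : conj y * y = n%:~R + cgJ *~ lam.
    rewrite -xx /y conjM /conj actd ?oppr1_neq0 // mulN1r mulrACA -cgdD addNr.
    by rewrite cgd0 mul1r.
  have aVN0 : a^-1 != 0 by rewrite invr_eq0.
  rewrite -xw /x /conj act_act mulrC [-1 * _]mulrC -act_act -actM // mulrC -/(conj y) yy.
  by rewrite actD actMz actJ act_int.
have ee : e * e = e by case: e01 => ->.
have [c eqc] := quartic_equation ee xx'.
have k1Z : q%:Z + e = n%:Z + lam%:Z by rewrite -eE k1.
have k2Z : (q%:Z + e) * (q%:Z + e) = n%:Z + lam%:Z * p%:Z by rewrite -eE -PoszM k2.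
have [e1 q3] := quartic_arith e01 k1Z k2Z eqc.
split=> //; exists a, d; split=> // i.
have := congr1 (fun z : cgr p => z i) xw; rewrite xE cgD qresE cgint e1 mulr1.
have [->|iN0] := eqVneq i 0; first by rewrite exp0_q eq_sym oner_eq0 /=; case: (_ \in X).
by rewrite orbF addr0; case: (_ \in X); case: eqP.
Qed.

End QuarticResidues.

(** * The projective plane of order 3 *)

Lemma color_schurian_ker p (T T' : eqType) (k : dih p -> T) (k' : dih p -> T') :
  (forall u v, (k u == k v) = (k' u == k' v)) -> color_schurian k' -> color_schurian k.
Proof.
move=> kk' H u v /eqP; rewrite kk' => /eqP/H[f [f1 fu fk]].
by exists f; split=> // a b; apply/eqP; rewrite kk'; apply/eqP.
Qed.

Lemma color_schurian_aut p (T : eqType) (k : dih p -> T) (s : {perm dih p}) :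
    s (d1 p) = d1 p -> (forall a b, s (ddiv a b) = ddiv (s a) (s b)) ->
  color_schurian (fun u => k (s u)) -> color_schurian k.
Proof.
move=> s1 sdiv H u v kuv; have [|f [f1 fu fk]] := H (s^-1%g u) (s^-1%g v).
  by rewrite !permKV.
exists (s^-1 * f * s)%g; split.
- by rewrite !permM -{1}s1 permK f1 s1.
- by rewrite !permM fu permKV.
move=> a b; rewrite !permM -sdiv fk sdiv !permKV //.
Qed.

Section ProjectivePlane.

(* The lines of PG(2,3) are the translates of [- planar13]; [colli_point] and *)
(* [colli_line] describe a collineation of order 6 fixing the point 0.        *)
Definition planar13 := [:: 0; 1; 3; 9]%N.

Definition color13 (u : dih 13) : nat :=
  if u.1 then (if (u.2 : nat) \in planar13 then 2%N else 3%N)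
  else if (u.2 : nat) == 0%N then 0%N else 1%N.

Definition colli_point := [:: 0; 1; 3; 7; 9; 11; 4; 2; 10; 12; 6; 5; 8]%N.
Definition colli_line := [:: 9; 1; 4; 3; 10; 12; 7; 5; 11; 0; 2; 6; 8]%N.

Definition colli (u : dih 13) : dih 13 :=
  (u.1, inZp (nth 0%N (if u.1 then colli_line else colli_point) u.2)).

(** A group automorphism; multiplication by 3 permutes [planar13] mod 13. *)
Definition mult3 (u : dih 13) : dih 13 := (u.1, inZp (3 * u.2)).

Definition base13 c : dih 13 :=
  nth (false, inZp 0) [:: (false, inZp 0); (false, inZp 4); (true, inZp 0); (true, inZp 5)] c.

Definition dih13 := [seq (b, inZp i) : dih 13 | b <- [:: false; true], i <- iota 0 13].

Lemma mem_dih13 (u : dih 13) : u \in dih13.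
Proof.
case: u => b i; apply/allpairsP; exists (b, i : nat); split.
- by case: b.
- by rewrite mem_iota; apply: (ltn_ord i).
- by rewrite /= valZpK.
Qed.

(** Automorphisms are plain functions here, so that they can be evaluated; bijectivity follows from
    the preservation of colours. *)
Definition color13_auto (f : dih 13 -> dih 13) :=
  f (d1 13) = d1 13 /\ forall a b, color13 (ddiv (f a) (f b)) = color13 (ddiv a b).

Lemma color13_auto_check f : f (d1 13) = d1 13 ->
  all (fun a => all (fun b => color13 (ddiv (f a) (f b)) == color13 (ddiv a b)) dih13) dih13 ->
  color13_auto f.
Proof.
move=> f1 /allP H; split=> // a b; apply/eqP.
exact: (allP (H a (mem_dih13 a)) b (mem_dih13 b)).
Qed.

Lemma colli_auto : color13_auto colli.
Proof. by apply: color13_auto_check; [apply/eqP |]; vm_compute. Qed.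

Lemma mult3_auto : color13_auto mult3.
Proof. by apply: color13_auto_check; [apply/eqP |]; vm_compute. Qed.

Lemma iter_auto f n : color13_auto f -> color13_auto (iter n f).
Proof.
move=> [f1 fk]; elim: n => [|n [IH1 IHk]]; first by split.
by split=> [|a b] /=; rewrite ?IH1 // fk.
Qed.

Lemma color13_1 (u : dih 13) : color13 u = color13 (d1 13) -> u = d1 13.
Proof.
case: u => [[] i]; rewrite /color13 /=; first by case: ifP.
by case: i => [[|i] lti] //= _; congr (_, _); apply: val_inj.
Qed.

(** A finite computation: words in [mult3] and [colli] take the representative [base13] of each
    colour to every element of that colour. Two elements are then related through their common
    representative. *)
Lemma color13_schurian : color_schurian color13.
Proof.
have word v : exists2 f, color13_auto f & f (base13 (color13 v)) = v.
  have /hasP[i _ /hasP[j _ /eqP E]] :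
      has (fun i => has (fun j => iter i mult3 (iter j colli (base13 (color13 v))) == v)
        (iota 0 6)) (iota 0 3).
    have /allP : all (fun v => has (fun i => has (fun j =>
        iter i mult3 (iter j colli (base13 (color13 v))) == v) (iota 0 6)) (iota 0 3)) dih13.
      by vm_compute.
    by apply; apply: mem_dih13.
  exists (iter i mult3 \o iter j colli) => //.
  have [a1 ak] := iter_auto i mult3_auto; have [b1 bk] := iter_auto j colli_auto.
  by split=> [|a b] /=; rewrite ?b1 ?ak.
have auto_perm f : color13_auto f -> exists s : {perm dih 13}, s =1 f.
  move=> [f1 fk]; have f_inj : injective f.
    by move=> a b fab; apply/ddiv_eq1/color13_1; rewrite -fk fab ddivvv.
  by exists (perm f_inj) => u; rewrite permE.
move=> u v uv; have [f [f1 fk] fu] := word u; have [g [g1 gk] gv] := word v.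
have [|s sE] := auto_perm f; first by split.
have [|t tE] := auto_perm g; first by split.
have s1 : s^-1%g (d1 13) = d1 13 by rewrite -{1}f1 -sE permK.
exists (s^-1 * t)%g; split.
- by rewrite permM s1 tE g1.
- by rewrite permM -{1}fu -sE permK tE uv gv.
move=> a b; rewrite !permM !tE gk.
by rewrite -[in RHS](permKV s a) -[in RHS](permKV s b) !sE fk.
Qed.

End ProjectivePlane.

(** * The general case *)

Section PureColoringSchurian.

Variables (p : nat) (p_pr : prime p) (T : finType) (k : dih p -> T).
Hypothesis kS : Scoloring k.
Hypothesis pure : forall i j, k (false, i) <> k (true, j).

Notation c := (fun i => k (false, i)).
Notation s := (fun i => k (true, i)).

Lemma full_valency : cvalency k = p.-1 -> forall t, t != 0 -> c t = c 1.
Proof.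
move=> val t tN0; have : [set t : 'F_p | c t == c 1] = [set t | t != 0].
  apply/eqP; rewrite eqEcard; apply/andP; split.
    apply/subsetP=> l; rewrite !inE => /eqP cl; apply: contra (oner_neq0 'F_p) => /eqP l0.
    by rewrite l0 in cl; rewrite (pure_c0 kS (esym cl)).
  rewrite -[#|[set t | c t == c 1]|]/(cvalency k) val -(card_Fp_neq0 p_pr).
  by rewrite cardsE.
by move/setP/(_ t); rewrite !inE tN0 => /eqP.
Qed.

Lemma planar_schurian (a d : 'F_p) (A : T) : p = 13 ->
    cvalency k = p.-1 -> #|scolors k| = 2 ->
    a != 0 -> (forall i, (s (a * i - d) == A) = (i ^+ 3 == 1) || (i == 0)) ->
  color_schurian k.
Proof.
move=> p13 val s2 aN0 sA.
pose f (u : dih p) : dih p := (u.1, if u.1 then a * u.2 - d else a * u.2).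
have f_inj : injective f.
  move=> u v E; move: (congr1 fst E) (congr1 snd E).
  by rewrite /f; case: u v {E} => [[] i] [[] j] //= _ => [/addIr/(mulfI aN0)->|/(mulfI aN0)->].
have cP i j : (c i == c j) = ((i == 0) == (j == 0)).
  have cN0 := full_valency val.
  have c01 : c 0 == c 1 = false.
    by apply/eqP => /esym/(pure_c0 kS)/eqP; rewrite oner_eq0.
  have [->|iN0] := eqVneq i 0; have [->|jN0] := eqVneq j 0; rewrite ?eqxx //.
  - by rewrite (cN0 j).
  - by rewrite (cN0 i) // eq_sym.
  - by rewrite (cN0 i) // (cN0 j) // eqxx.
have sP i j : (s i == s j) = ((s i == A) == (s j == A)).
  have sin l : s l \in scolors k by apply: imset_f; rewrite inE.
  have A_in : A \in scolors k.
    have : s (a * 0 - d) == A by rewrite sA eqxx orbT.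
    by move/eqP <-.
  have := s2; rewrite (cardsD1 A) A_in => -[] /eqP/cards1P[B BE].
  have sAB l : s l != A -> s l = B.
    by move=> slA; apply/eqP; rewrite -in_set1 -BE !inE slA sin.
  have BA : B != A by have := set11 B; rewrite -BE !inE => /andP[].
  have [iA|iA] := eqVneq (s i) A; have [jA|jA] := eqVneq (s j) A; rewrite ?iA ?jA ?eqxx //.
  - by rewrite eq_sym (negPf jA).
  - by rewrite (negPf iA).
  - by rewrite (sAB i) // (sAB j) // eqxx.
apply: (@color_schurian_aut _ _ _ (perm f_inj)).
- by rewrite permE /f /= mulr0.
- move=> u v; rewrite !permE /f !ddivE; case: u v => [[] i] [[] j] /=;
  by congr (_, _); ring.
have key (u v : dih p) : (k (f u) == k (f v)) =
    if u.1 then v.1 && (((u.2 ^+ 3 == 1) || (u.2 == 0)) == ((v.2 ^+ 3 == 1) || (v.2 == 0)))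
    else ~~ v.1 && ((u.2 == 0) == (v.2 == 0)).
  case: u v => [[] i] [[] j]; rewrite /f /=.
  - by rewrite sP !sA.
  - by apply/eqP=> /esym/pure.
  - by apply/eqP=> /pure.
  by rewrite cP !mulf_eq0 (negPf aN0).
pose k' u := k (f u); apply: (@color_schurian_ker _ _ _ _ k').
  by move=> u v; rewrite !permE.
(* Only the kernel of the colouring, expressed in the field, is retained; [p] can then be replaced
   by 13 and the kernel compared with that of [color13] by computation. *)
move: k' (fun u v => key u v : (k' u == k' v) = _); clear -p13; subst p.
move=> k' key; apply: (color_schurian_ker (k' := color13)) color13_schurian => u v.
rewrite key; apply/eqP.
have /allP/(_ u (mem_dih13 u))/allP/(_ v (mem_dih13 v)) // :
  all (fun u : dih 13 => all (fun v : dih 13 =>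
   (if u.1 then v.1 && (((u.2 ^+ 3 == 1) || (u.2 == 0)) == ((v.2 ^+ 3 == 1) || (v.2 == 0)))
    else ~~ v.1 && ((u.2 == 0) == (v.2 == 0))) == (color13 u == color13 v)) dih13) dih13.
by vm_compute.
Qed.

(** All nontrivial rotations form one class, so conj x * x is constant off 0: the reflections of
    colour A form a difference set. *)
Lemma two_class_diffset (A : T) (q : nat) : prime q -> odd q -> p = (2 * (2 * q)).+1 ->
    cvalency k = p.-1 -> #|scolors k| = 2 -> A \in scolors k ->
    ssize k A = q \/ ssize k A = q.+1 ->
  color_schurian k.
Proof.
move=> q_pr q_odd p_def val s2 As sizeA.
pose X := [set j | s j == A]; pose x := ind X.
have sx : class_fun s x by move=> i j sij; rewrite !indE !inE sij.
have cxx := pure_ssM kS pure sx sx; set w := conj x * x in cxx.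
have c1 := full_valency val.
have w1_ge0 : 0 <= w 1.
  by rewrite cgM_conj; apply: sumr_ge0 => j _; rewrite !indE; case: (_ \in _); case: (_ \in _).
have w01 : w 1 <= w 0 by rewrite aug_ind_mul0; apply: corr_le.
have xx : conj x * x = (absz (w 0 - w 1)%R)%:~R + cgJ *~ absz (w 1%R).
  rewrite !gez0_abs ?subr_ge0 //; apply/ffunP=> i.
  rewrite -/w cgD cgint cgMz cgJE mul1r; have [->|iN0] := eqVneq i 0.
    by rewrite mul1r subrK.
  by rewrite mul0r add0r; apply: cxx; apply: c1.
have [q3 [a [d [aN0 Xad]]]] := quartic_diffset p_pr q_pr q_odd p_def xx sizeA.
apply: (@planar_schurian a d A) => //; first by rewrite p_def q3.
by move=> i; have := Xad i; rewrite inE q3.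
Qed.

(** The hypothesis amounts to 4q dividing K (K - 1). As K and K - 1 are coprime, q divides one of
    them and so does 4; the bound on K then leaves q, q + 1 and 2q, and 4 divides neither 2q nor 2q
    - 1. *)
Lemma size_2cases K q : prime q -> odd q -> (1 < K <= 2 * q)%N ->
  (4 * q %| K * (4 * q + 1 - K))%N -> K = q \/ K = q.+1.
Proof.
move=> q_pr q_odd /andP[K_gt1 K_le] dvd.
have q_gt0 := prime_gt0 q_pr.
have {dvd} : (4 * q %| K * K.-1)%N.
  have E : (K * K.-1 + K * (4 * q + 1 - K) = K * (4 * q))%N.
    by rewrite -mulnDr; congr (_ * _)%N; lia.
  by rewrite -(dvdn_addl _ dvd) E dvdn_mull.
have co : coprime K K.-1 by rewrite coprime_sym -{2}(prednK (ltnW K_gt1)) coprimenS.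
have pw l e : prime l -> (l ^ e %| K * K.-1)%N -> (l ^ e %| K)%N \/ (l ^ e %| K.-1)%N.
  move=> l_pr; have [lK|lK] := boolP (l %| K)%N.
    have col : coprime (l ^ e) K.-1.
      by apply: coprimeXl; rewrite prime_coprime //; apply: contraL co => lK1;
         apply/negP=> co'; have := coprime_dvdl lK co'; rewrite prime_coprime // lK1.
    by rewrite Gauss_dvdl //; left.
  have col : coprime (l ^ e) K by apply: coprimeXl; rewrite prime_coprime.
  by rewrite Gauss_dvdr //; right.
move=> d4q; have d4 : (2 ^ 2 %| K * K.-1)%N by apply: dvdn_trans d4q; apply: dvdn_mulr.
have dq : (q ^ 1 %| K * K.-1)%N by apply: dvdn_trans d4q; rewrite expn1; apply: dvdn_mull.
case: (pw q 1%N q_pr dq); rewrite expn1 => /dvdnP[x xE].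
  have : (x = 1 \/ x = 2)%N by nia.
  case=> x12; first by left; rewrite xE x12 mul1n.
  by case: (pw 2 2 isT d4) => /dvdnP[z zE]; rewrite x12 in xE; lia.
have : (x = 1)%N by nia.
by move=> x1; right; rewrite x1 mul1n in xE; lia.
Qed.

Lemma pure_color_schurian :
  fermat_prime p \/ (exists2 q : nat, prime q & p = (4 * q + 1)%N) -> color_schurian k.
Proof.
move=> hp.
have [/existsP[i /existsP[j sij]]|s_const] := boolP [exists i, [exists j, s i != s j]]; last first.
  apply: (pure_constant_schurian p_pr kS pure) => i j; apply/eqP.
  by move: s_const; rewrite negb_exists => /forallP/(_ i); rewrite negb_exists => /forallP/(_ j)/negPn.
have nonconst : exists i j, s i <> s j by exists i, j; apply/eqP.
have [r [rm card_s sum_s s_gt0 dvd_s]] := pure_sizes p_pr kS pure nonconst.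
rewrite -[in RHS]rm in sum_s.
have by_one : (exists2 a, a \in scolors k & ssize k a = 1%N) -> color_schurian k.
  by case=> a sa; apply: (size1_schurian p_pr kS pure sa).
have by_prime_power l e : prime l -> cvalency k = (l ^ e)%N -> color_schurian k.
  move=> l_pr val; apply: by_one; rewrite val in sum_s dvd_s.
  exact: (prime_power_size1 l_pr card_s sum_s s_gt0 dvd_s).
case: hp => [[_ [e _ pE]]|[q q_pr pE]].
  (* For a Fermat prime the order of M divides p - 1, a power of 2. *)
  have : (cvalency k %| 2 ^ e)%N by apply/dvdnP; exists r; lia.
  by case/(dvdn_pfactor _ _ (isT : prime 2)) => f _; apply: by_prime_power.
have q_gt1 := prime_gt1 q_pr.
have q_odd : odd q.
  case/even_prime: (q_pr) => // q2; move: p_pr; rewrite pE q2 //.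
have mr : (r * cvalency k = 4 * q)%N by lia.
have m4q : (cvalency k %| q * 4)%N by apply/dvdnP; exists r; lia.
(* If q does not divide the order of M, that order divides 4 and is a prime power. Otherwise it is
   q, 2q or 4q. *)
have [/dvdnP[m' mE]|qm] := boolP (q %| cvalency k)%N; last first.
  have : (cvalency k %| 2 ^ 2)%N.
    by move: m4q; rewrite Gauss_dvdr // coprime_sym prime_coprime.
  by case/(dvdn_pfactor _ _ (isT : prime 2)) => f _; apply: by_prime_power.
have : (m' %| 2 ^ 2)%N.
  by move: m4q; rewrite mE mulnC dvdn_pmul2l // prime_gt0.
case/(dvdn_pfactor _ _ (isT : prime 2)) => f f_le m'E.
have [/existsP[a /andP[sa co]]|] := boolP [exists a, (a \in scolors k) && coprime (cvalency k) (ssize k a)].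
  apply: by_one; exists a => //; exact: (coprime_size1 card_s sum_s s_gt0 dvd_s sa co).
rewrite negb_exists => /forallP noco.
have {}noco a : a \in scolors k -> ~~ coprime (cvalency k) (ssize k a).
  by move=> sa; have := noco a; rewrite sa.
have p_def : p = (2 * (2 * q)).+1 by lia.
case: f f_le m'E => [|[|[|//]]] _ m'E; rewrite {}m'E in mE.
- by apply: (by_prime_power q 1%N q_pr); rewrite mE expn1 mul1n.
- have r2 : r = 2 by move: mr; rewrite mE; nia.
  rewrite r2 mE expn1 in card_s sum_s dvd_s noco.
  have q_gt2 : (2 < q)%N by case: q q_gt1 q_odd {pE q_pr m4q mE mr p_def sum_s dvd_s noco} => [|[|[|]]].
  case: (no_sizes_2q p_pr kS pure q_gt2 p_def); first by rewrite mE expn1.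
  exact: (sizes_2q q_pr q_odd card_s sum_s s_gt0 dvd_s noco).
have r1 : r = 1%N by move: mr; rewrite mE; nia.
have val : cvalency k = p.-1 by rewrite mE p_def /=; lia.
rewrite r1 in card_s.
have [a [b [ab sE]]] : exists a b, a != b /\ scolors k = [set a; b].
  by have /eqP/cards2P[a [b [ab sE]]] := card_s; exists a, b.
have sa : a \in scolors k by rewrite sE !inE eqxx.
have sb : b \in scolors k by rewrite sE !inE eqxx orbT.
have sum2 : (ssize k a + ssize k b = 4 * q + 1)%N.
  by move: sum_s; rewrite sE big_setU1 ?inE //= big_set1; lia.
have not1 t : t \in scolors k -> (1 < ssize k t)%N.
  move=> st; have := s_gt0 t st; rewrite leq_eqVlt => /orP[/eqP s1|//].
  by have := noco t st; rewrite -s1 coprimen1.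
have dvd2 t u : t \in scolors k -> u \in scolors k -> t != u -> (ssize k t + ssize k u = 4 * q + 1)%N ->
    (4 * q %| ssize k t * (4 * q + 1 - ssize k t))%N.
  move=> st su tu E; have -> : (4 * q + 1 - ssize k t = ssize k u)%N by lia.
  by have := dvd_s t u st su tu; rewrite mE.
(* The two sizes sum to 4q + 1, so one of them is at most 2q. *)
have [lea|ltb] := leqP (ssize k a) (2 * q).
  apply: (@two_class_diffset a q) => //; apply: size_2cases => //; first by rewrite not1.
  exact: (dvd2 a b).
apply: (@two_class_diffset b q) => //; apply: size_2cases => //.
  by rewrite not1 //=; lia.
by apply: (dvd2 b a); rewrite // 1?eq_sym // addnC.
Qed.

End PureColoringSchurian.

Lemma Scoloring_schurian p (T : finType) (k : dih p -> T) : prime p -> Scoloring k ->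
  fermat_prime p \/ (exists2 q : nat, prime q & p = (4 * q + 1)%N) -> color_schurian k.
Proof.
move=> p_pr kS hp.
have [/existsP[i /existsP[j /eqP mix]]|pure] :=
  boolP [exists i, [exists j, k (false, i) == k (true, j)]].
  exact: (mixed_color_schurian p_pr kS mix).
apply: (pure_color_schurian p_pr kS) hp => i j /eqP E.
by move: pure; rewrite negb_exists => /forallP/(_ i); rewrite negb_exists => /forallP/(_ j); rewrite E.
Qed.

(** * From S-rings over a dihedral group to colourings and back *)

Section Model.

Variables (gT : finGroupType) (p : nat) (e : dih p -> gT).
Hypothesis eM : forall u v, e (dmul u v) = (e u * e v)%g.
Hypothesis e_bij : bijective e.

Lemma model1 : e (d1 p) = 1%g.
Proof.
apply: (mulgI (e (d1 p))); rewrite mulg1 -eM.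
by congr e; rewrite /dmul /= addr0.
Qed.

Lemma modelV u : e (dinv u) = (e u)^-1%g.
Proof.
apply: (mulIg (e u)); rewrite mulVg -eM -model1; congr e.
by case: u => [[] i]; rewrite /dmul /dinv /= ?addNr.
Qed.

Lemma model_div u v : e (ddiv u v) = (e u * (e v)^-1)%g.
Proof. by rewrite eM modelV. Qed.

Lemma zgMz (a : zgring gT) (n : int) g : (a *~ n) g = a g * n.
Proof.
have Mn m : (a *+ m) g = a g *+ m.
  by elim: m => [|m IHm]; rewrite ?mulr0n ?ffunE // !mulrS ffunE IHm.
case: n => n; first by rewrite -pmulrn Mn -mulr_natr natz.
by rewrite NegzE mulrNz ffunE -pmulrn Mn -mulr_natr natz mulrN.
Qed.

Lemma zg_sum (I : Type) (r : seq I) (Q : pred I) (F : I -> zgring gT) g :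
  (\sum_(i <- r | Q i) F i) g = \sum_(i <- r | Q i) F i g.
Proof. by elim/big_rec2: _ => [|i u v _ <-]; rewrite ffunE. Qed.

Lemma set_sumE (X : {set gT}) g : set_sum X g = (g \in X)%:R.
Proof.
rewrite zg_sum; under eq_bigr do rewrite ffunE.
have [Xg|X'g] := boolP (g \in X).
  by rewrite (bigD1 g) //= eqxx big1 ?addr0 // => h /andP[_]; rewrite eq_sym => /negPf->.
by rewrite big1 // => h Xh; case: eqP => // gh; rewrite gh Xh in X'g.
Qed.

Section Partition.

Variables (P : {set {set gT}}) (partP : partition P [set: gT]).

Lemma part_triv : trivIset P. Proof. by case/and3P: partP. Qed.

Lemma mem_part g : g \in pblock P g.
Proof. by rewrite mem_pblock (cover_partition partP) inE. Qed.

Lemma pblock_part g : pblock P g \in P.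
Proof. by apply: pblock_mem; rewrite (cover_partition partP) inE. Qed.

Lemma part_mem X g : X \in P -> (g \in X) = (pblock P g == X).
Proof.
move=> PX; apply/idP/eqP => [Xg|<-]; last exact: mem_part.
exact: (def_pblock part_triv PX Xg).
Qed.

Lemma part_pblock_eq g h : (pblock P h == pblock P g) = (h \in pblock P g).
Proof. by rewrite (part_mem _ (pblock_part g)). Qed.

Lemma in_zspanP (a : zgring gT) :
  in_zspan P a <-> forall g h, pblock P g = pblock P h -> a g = a h.
Proof.
have E (f : {set gT} -> int) g : (\sum_(X in P) set_sum X *~ f X) g = f (pblock P g).
  rewrite zg_sum (bigD1 (pblock P g)) ?pblock_part //= zgMz set_sumE mem_part mul1r.
  rewrite big1 ?addr0 // => X /andP[PX]; rewrite zgMz set_sumE part_mem // eq_sym => /negPf->.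
  by rewrite mul0r.
split=> [[f ->] g h gh|aP]; first by rewrite !E gh.
exists (fun X => a (repr X)); apply/ffunP=> g; rewrite E; apply: aP; apply/eqP.
by rewrite eq_sym part_pblock_eq; apply: (mem_repr g); apply: mem_part.
Qed.

Definition zg_pair (e' : gT -> dih p) (x y : cgr p) : zgring gT := [ffun g => pv x y (e' g)].

Variables (A : {pred zgring gT}) (Asub : GRing.subring_closed A).
Hypothesis A_span : forall a, a \in A <-> in_zspan P a.
Hypothesis P1 : [set 1%g] \in P.
Hypothesis PV : forall X : {set gT}, X \in P -> (X^-1)%g \in P.

Definition pcolor u := pblock P (e u).

Lemma pblockV g : pblock P (g^-1)%g = ((pblock P g)^-1)%g.
Proof.
apply/eqP; rewrite -part_mem ?PV ?pblock_part //.
by rewrite mem_invg invgK mem_part.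
Qed.

Lemma Scoloring_pcolor : Scoloring pcolor.
Proof.
have [e' eK e'K] := e_bij.
have inA x y : zg_pair e' x y \in A <-> pair_class_fun pcolor x y.
  rewrite A_span in_zspanP; split=> H.
    by move=> u v /H; rewrite !ffunE !eK.
  by move=> g h gh; rewrite !ffunE; apply: H; rewrite /pcolor !e'K.
split=> [u uP|x y|x y x' y' /inA a1 /inA a2].
- have: e u \in [set 1%g].
    by rewrite part_mem // -[pblock P _]/(pcolor u) uP /pcolor model1 -part_mem ?set11.
  by rewrite inE -model1 => /eqP/(can_inj eK).
- move=> H u v uv; have pvV w : pv (conj x) y w = pv x y (dinv w).
    by case: w => [[] i]; rewrite /pv //= conjE.
  by rewrite !pvV; apply: H; rewrite /pcolor !modelV !pblockV -/(pcolor u) uv.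
apply/inA; have [_ _ AM] := Asub; have := AM _ _ a1 a2; congr (_ \in A).
(* The convolution, transported along e and split according to rotations and reflections, is the
   product formula of [ScoloringM]. *)
apply/ffunP=> g; rewrite -[g]e'K; move: (e' g) => u; rewrite [LHS]ffunE [RHS]ffunE eK.
rewrite (reindex e) /=; last by exists e' => h _; [apply: eK | apply: e'K].
under eq_bigr => w _ do rewrite !ffunE -modelV -eM !eK.
transitivity (\sum_b \sum_i pv x y (b, i) * pv x' y' (dmul (dinv (b, i)) u)).
  by rewrite pair_bigA; apply: eq_bigr => -[b i] _.
rewrite big_bool /=; case: u => [[] d]; rewrite /pv /dmul /dinv /= cgD.
  rewrite cgM_conj cgM addrC; congr (_ + _); apply: eq_bigr => i _ /=.
    by rewrite opprK addrC.
  by rewrite addrC.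
rewrite cgM_conj cgM addrC; congr (_ + _); apply: eq_bigr => i _ /=.
  by rewrite addrC.
by rewrite addrC.
Qed.

(** The automorphism group of the S-ring; as the condition only involves g h^-1, it contains the
    right translations. *)
Definition colored_aut : {set {perm gT}} :=
  [set s : {perm gT} | [forall g, forall h, pblock P (s g * (s h)^-1)%g == pblock P (g * h^-1)%g]].

Lemma colored_autP (s : {perm gT}) :
  reflect (forall g h, pblock P (s g * (s h)^-1)%g = pblock P (g * h^-1)%g) (s \in colored_aut).
Proof.
rewrite inE; apply: (iffP idP) => [/forallP H g h|H].
  exact: (eqP (forallP (H g) h)).
by apply/forallP=> g; apply/forallP=> h; apply/eqP.
Qed.

Lemma colored_aut_group_set : group_set colored_aut.
Proof.
apply/group_setP; split; first by apply/colored_autP=> g h; rewrite !perm1.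
move=> s t /colored_autP Hs /colored_autP Ht; apply/colored_autP=> g h.
by rewrite !permM Ht Hs.
Qed.

(** An automorphism fixing 1 maps every class to itself, as seen by taking h = 1; by hypothesis
    these automorphisms are transitive on each class, so the classes are the orbits of the
    stabilizer. *)
Lemma schurian_pcolor : color_schurian pcolor -> schurian A.
Proof.
move=> Hk; have [e' eK e'K] := e_bij.
exists (Group colored_aut_group_set) => [|a].
  apply/subsetP=> _ /morphimP[g _ _ ->]; apply/colored_autP=> h h'.
  by rewrite !actpermE /= invMg mulgA mulgK.
rewrite A_span /in_transitivity_module.
suff -> : stab1_orbits (Group colored_aut_group_set) = P by [].
have orbE g : orbit 'P 'C_(Group colored_aut_group_set)[1%g | 'P] g = pblock P g.
  apply/setP=> h; rewrite -part_pblock_eq; apply/orbitP/eqP => [[s /setIP[sK]]|hg].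
    move/astab1P => /= s1 <-; move/colored_autP: sK => /(_ g 1%g).
    by rewrite /= /aperm in s1 *; rewrite s1 !invg1 !mulg1.
  have kgh : pcolor (e' g) = pcolor (e' h) by rewrite /pcolor !e'K.
  have [f [f1 fg fk]] := Hk _ _ kgh.
  have s_inj : injective (fun x => e (f (e' x))).
    by apply: inj_comp (can_inj eK) _; apply: inj_comp perm_inj (can_inj e'K).
  exists (perm s_inj); last by rewrite /= /aperm permE fg e'K.
  apply/setIP; split.
    apply/colored_autP=> x y; rewrite !permE -model_div -[LHS]/(pcolor _) fk.
    by rewrite /pcolor model_div !e'K.
  by apply/astab1P; rewrite /= /aperm permE -{1}model1 eK f1 model1.
apply/setP=> X; apply/imsetP/idP => [[g _ ->]|PX]; first by rewrite orbE pblock_part.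
have [g Xg] : exists g, g \in X.
  by apply/set0Pn; apply: contraTneq PX => ->; case/and3P: partP.
by exists g; rewrite ?inE // orbE; apply/esym/eqP; rewrite -part_mem.
Qed.

End Partition.

Lemma Schur_group_model : prime p ->
  fermat_prime p \/ (exists2 q : nat, prime q & p = (4 * q + 1)%N) -> Schur_group gT.
Proof.
move=> p_pr hp A [Asub [P [partP P1 PV A_span]]].
apply: (schurian_pcolor partP A_span).
exact: Scoloring_schurian p_pr (Scoloring_pcolor partP Asub A_span P1 PV) hp.
Qed.

End Model.

(** The presentation provides generators x and y with the dihedral relations, which make [e]
    multiplicative. Its image is a subgroup containing x and y, so [e] is onto, and both sides have
    2p elements. *)
Lemma dihedral_model p : prime p -> (2 < p)%N ->
  exists e : dih p -> 'D_(2 * p)%N,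
    (forall u v, e (dmul u v) = (e u * e v)%g) /\ bijective e.
Proof.
move=> p_pr p_gt2; rewrite mul2n.
have p_gt1 := prime_gt1 p_pr.
have : [set: 'D_(p.*2)] \isog [set: 'D_(p.*2)] by apply: isog_refl.
case/(isoGrpP _ (Grp_dihedral p_gt1)) => _ /existsP[[x y] /= /eqP[defG xp y2 xy]].
pose e (u : dih p) : 'D_(p.*2) := (y ^+ u.1 * x ^+ u.2)%g.
have xmod n : (x ^+ (n %% p) = x ^+ n)%g by rewrite expg_mod.
have xD (i j : 'F_p) : (x ^+ (i + j)%R = x ^+ i * x ^+ j)%g.
  rewrite -expgD -[RHS]xmod; congr (_ ^+ _)%g; rewrite /=; congr (_ %% _)%N; exact: Fp_cast.
have x0 : (x ^+ (0%R : 'F_p) = 1)%g by [].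
have xN (i : 'F_p) : (x ^+ (- i)%R = (x ^+ i)^-1)%g.
  by apply: (mulgI (x ^+ i)%g); rewrite -xD subrr x0 mulgV.
have xyC n : (x ^+ n * y = y * (x ^+ n)^-1)%g.
  by rewrite conjgC conjXg xy expgVn.
have eE b i : e (b, i) = (y ^+ b * x ^+ i)%g by [].
have eM u v : e (dmul u v) = (e u * e v)%g.
  case: u v => [b i] [[] j].
    rewrite -[dmul _ _]/((b (+) true, - i + j)%R : dih p) !eE xD xN.
    rewrite [(y ^+ true)%g]expg1 -!mulgA (mulgA (x ^+ i)%g) xyC !mulgA.
    congr (_ * _ * _)%g; case: b; last by rewrite expg0 mul1g expg1.
    by rewrite expg1 -[(y * y)%g]/(y ^+ 2)%g y2.
  rewrite -[dmul _ _]/((b (+) false, i + j)%R : dih p) !eE xD addbF.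
  by rewrite [(y ^+ false)%g]expg0 mul1g mulgA.
exists e; split=> //.
have card_eq : #|{: dih p}| = #|{: 'D_(p.*2)}|.
  by rewrite card_prod card_bool card_Fp // -cardsT card_dihedral // -mul2n.
have e_surj g : g \in codom e.
  have gG : group_set [set h | h \in codom e].
    apply/group_setP; split.
      by rewrite inE; apply/codomP; exists (d1 p); rewrite /e /= x0 mulg1.
    move=> _ _ /[!inE] /codomP[u ->] /codomP[v ->].
    by apply/codomP; exists (dmul u v); rewrite eM.
  have : g \in [set: 'D_(p.*2)] by rewrite inE.
  rewrite -defG => /(subsetP _) H; suff /H : (<[x]> <*> <[y]> \subset Group gG)%g by rewrite inE.
  rewrite join_subG !cycle_subG !inE; apply/andP; split; apply/codomP.
    by exists (false, 1); rewrite /e /= mul1g modn_small // expg1.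
  by exists (true, 0); rewrite /e /= x0 mulg1 expg1.
have e_inj : injective e.
  apply/injectiveP/card_uniqP; rewrite size_map -cardE card_eq.
  by apply: eq_card => g; rewrite e_surj inE.
by apply: inj_card_bij e_inj _; rewrite card_eq.
Qed.

Theorem theorem1p3 (p : nat) (p_prime : prime p)
    (hp : fermat_prime p \/ exists2 q : nat, prime q & p = (4 * q + 1)%N) :
  Schur_group ('D_(2 * p)%N)%type.
Proof.
have p_gt2 : (2 < p)%N.
  rewrite ltn_neqAle prime_gt1 // andbT eq_sym; apply/eqP=> p2.
  by case: hp => [[_ [[//|k] _]]|[q _]]; rewrite p2 ?expnS; lia.
have [e [eM e_bij]] := dihedral_model p_prime p_gt2.
exact: (Schur_group_model eM e_bij p_prime hp).
Qed.
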